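(* Consider the interacting urn process on a finite weakly connected directed graph $\mathcal G=(V,\mathcal E)$, $V=[N]=S\cup F$, with parameters $(q_i,m_i,\alpha_i,\beta_i)_{i\in V}$, as defined in the context. Suppose $F$ (the subgraph induced on the flexible nodes) is strongly connected and one of the following conditions holds: (i) there exists a node $i$ with $q_i\in(0,1)$; (ii) there exists a non-Pólya type node in $F$; (iii) there exists at least one stubborn node, i.e. $S\neq\emptyset$; (iv) $q_i\in\{0,1\}$ for all $i$, all nodes in $F$ are of Pólya type, and $F$ does not admit a valid graph partition under the exploration process. Then $\mathbf Z^t\to\mathbf Z^\star$ almost surely as $t\to\infty$, where $\mathbf Z^\star=(\mathbf Z^\star_F,\mathbf Z^0_S)$ and $$\mathbf Z_F^\star=\big[\mathbf Z_S^0(\mathcal I B\widetilde A)_{SF}+(\mathbf a\widetilde A)_F-(\mathbf q B\widetilde A)_F\big]\,\big(I-(\mathcal I B\widetilde A)_F\big)^{-1}.$$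
   Context: Graph. $\mathcal G=(V,\mathcal E)$ is a finite directed graph, $V=[N]=\{1,\dots,N\}$, weakly connected; $i\to j$ means there is a directed edge from $i$ to $j$. In-neighbourhood: $N_i=\{j\in V:j\to i\}$. Stubborn nodes: $S=\{i:N_i=\emptyset\}$; flexible nodes: $F=V\setminus S$, labelled so that $F=\{1,\dots,|F|\}$. $A$ is the adjacency matrix, $[A]_{i,j}=1$ if $i\to j$ and $0$ otherwise. Urn process. Each node $i$ has an urn with $W_i^t$ white and $B_i^t$ black balls at time $t$; $T_i^t=W_i^t+B_i^t$, $T_i^0>0$, $Z_i^t=W_i^t/T_i^t$, $\mathbf Z^t=(Z_1^t,\dots,Z_N^t)$ (row vector), $\mathcal F_t=\sigma(\mathbf Z^0,\dots,\mathbf Z^t)$; the initial configuration is fixed. Each node has parameters $q_i\in[0,1]$ and integers $m_i\ge1$, $\alpha_i,\beta_i\in\{0,\dots,m_i\}$. Given $\mathcal F_t$, the variables $\chi_i^{t+1}$, $i\in V$ (indicator that a white ball is drawn from urn $i$) are independent Bernoulli with $P(\chi_i^{t+1}=1\mid\mathcal F_t)=q_iZ_i^t+(1-q_i)(1-Z_i^t)$. Then for all $i\in V$, $W_i^{t+1}=W_i^t+\sum_{j\in N_i}[\alpha_j\chi_j^{t+1}+(m_j-\beta_j)(1-\chi_j^{t+1})]$ and $B_i^{t+1}=B_i^t+\sum_{j\in N_i}[(m_j-\alpha_j)\chi_j^{t+1}+\beta_j(1-\chi_j^{t+1})]$. Node $i$ is of Pólya type if $\alpha_i=\beta_i=m_i$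 and of non-Pólya type if $0<\alpha_i+\beta_i<2m_i$; every node is assumed to be of one of these two types. Node $i$ is preferential if $q_i=1$ and de-preferential if $q_i=0$. Matrix notation. Vectors are row vectors. $a_i=\alpha_i/m_i$, $b_i=\beta_i/m_i$, $\mathbf a=(a_1,\dots,a_N)$, $\mathbf q=(q_1,\dots,q_N)$, $\overline m_i=\sum_{j\in N_i}m_j$, $\mathcal I=\mathrm{Diag}(2q_1-1,\dots,2q_N-1)$, $B=\mathrm{Diag}(a_1+b_1-1,\dots,a_N+b_N-1)$, $M=\mathrm{Diag}(m_1,\dots,m_N)$, $\overline M^{-1}=\mathrm{Diag}(\overline m_1^{-1},\dots,\overline m_{|F|}^{-1},0,\dots,0)$ (zeros on $S$), $\widetilde A=MA\overline M^{-1}$. For a matrix $Q$, $Q_{SF}$ is the submatrix with rows in $S$ and columns in $F$, $Q_F=Q_{FF}$; for a vector $x$, $x_F$ is its restriction to $F$. Exploration process / valid graph partition. Let $H$ be a directed graph with node set $U$, each node being preferential or de-preferential; let $\mathcal P,\mathcal D$ be the sets of preferential and de-preferential nodes of $H$ and let $N_j$ denote in-neighbourhoods in $H$. Select a node $j\in U$; if $j\in\mathcal P$ initialise $P_1=\{j\}$, $P_2=D_1=D_2=\emptyset$; otherwise initialise $D_1=\{j\}$, $P_1=P_2=D_2=\emptyset$. While $P_1\cup P_2\cup D_1\cup D_2\subsetneq U$, perform in order the updates: (1) add $\bigcup_{j\in P_1}N_j\cap\mathcal P$ to $P_1$ and $\bigcup_{j\in P_1}N_j\cap\mathcal D$ to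 $D_1$; (2) add $\bigcup_{j\in D_1}N_j\cap\mathcal P$ to $P_2$ and $\bigcup_{j\in D_1}N_j\cap\mathcal D$ to $D_2$; (3) add $\bigcup_{j\in D_2}N_j\cap\mathcal P$ to $P_1$ and $\bigcup_{j\in D_2}N_j\cap\mathcal D$ to $D_1$; (4) add $\bigcup_{j\in P_2}N_j\cap\mathcal P$ to $P_2$ and $\bigcup_{j\in P_2}N_j\cap\mathcal D$ to $D_2$; if the four sets are not mutually disjoint, stop: $H$ does not admit a graph partition. Once the four sets cover $U$, perform updates (1)–(4) once more; if some node is re-assigned from $P_1$ to $P_2$ (or vice versa) or from $D_1$ to $D_2$ (or vice versa), $H$ does not admit a graph partition; otherwise $H$ admits the (valid) graph partition $(P_1,P_2,D_1,D_2)$. The outcome does not depend on the initial node. For $F$, apply this to the subgraph induced on $F$. *)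

(* Defs.v *)
From HB Require Import structures.
From mathcomp Require Import all_boot all_order all_algebra.

Set Implicit Arguments.
Unset Strict Implicit.
Unset Printing Implicit Defensive.

Import Order.TTheory GRing.Theory Num.Theory.

(* [e i j] is the directed edge i -> j. *)
Section DirectedGraph.
Variables (T : finType) (e : rel T).

Definition in_nbr (i : T) : {set T} := [set j | e j i].

Definition stubborn : {set T} := [set i | in_nbr i == set0].

Definition flexible : {set T} := ~: stubborn.

Definition weakly_connected : Prop :=
  forall i j : T, connect [rel x y | e x y || e y x] i j.

(* Paths stay inside U. *)
Definition strongly_connected_on (U : {set T}) : Prop :=
  forall i j, i \in U -> j \in U -> connect [rel x y in U | e x y] i j.

End DirectedGraph.

Record expl_state (T : finType) := ExplState {
  expl_P1 : {set T}; expl_P2 : {set T}; expl_D1 : {set T}; expl_D2 : {set T} }.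

(* H is the subgraph of [e] induced on [U]; [Pr] and [De] are its sets of
   preferential and de-preferential nodes. *)
Section Exploration.
Variables (T : finType) (e : rel T) (U Pr De : {set T}).

Definition in_nbrs (X : {set T}) : {set T} :=
  \bigcup_(j in X) (in_nbr e j :&: U).

Definition expl_init (j : T) : expl_state T :=
  if j \in Pr then ExplState [set j] set0 set0 set0
  else ExplState set0 set0 [set j] set0.

Definition expl_update1 (s : expl_state T) : expl_state T :=
  let: ExplState P1 P2 D1 D2 := s in
  ExplState (P1 :|: in_nbrs P1 :&: Pr) P2 (D1 :|: in_nbrs P1 :&: De) D2.

Definition expl_update2 (s : expl_state T) : expl_state T :=
  let: ExplState P1 P2 D1 D2 := s in
  ExplState P1 (P2 :|: in_nbrs D1 :&: Pr) D1 (D2 :|: in_nbrs D1 :&: De).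

Definition expl_update3 (s : expl_state T) : expl_state T :=
  let: ExplState P1 P2 D1 D2 := s in
  ExplState (P1 :|: in_nbrs D2 :&: Pr) P2 (D1 :|: in_nbrs D2 :&: De) D2.

Definition expl_update4 (s : expl_state T) : expl_state T :=
  let: ExplState P1 P2 D1 D2 := s in
  ExplState P1 (P2 :|: in_nbrs P2 :&: Pr) D1 (D2 :|: in_nbrs P2 :&: De).

Definition expl_round (s : expl_state T) : expl_state T :=
  expl_update4 (expl_update3 (expl_update2 (expl_update1 s))).

Definition expl_cover (s : expl_state T) : {set T} :=
  expl_P1 s :|: expl_P2 s :|: expl_D1 s :|: expl_D2 s.

Definition expl_disjoint (s : expl_state T) : bool :=
  let: ExplState P1 P2 D1 D2 := s in
  [&& [disjoint P1 & P2], [disjoint P1 & D1], [disjoint P1 & D2],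
      [disjoint P2 & D1], [disjoint P2 & D2] & [disjoint D1 & D2]].

(* Updates only add nodes, so a node re-assigned from X to Y is one that was in
   X before the round and is in Y after it. *)
Definition expl_reassigned (s s' : expl_state T) : bool :=
  [|| expl_P1 s :&: expl_P2 s' != set0, expl_P2 s :&: expl_P1 s' != set0,
      expl_D1 s :&: expl_D2 s' != set0 | expl_D2 s :&: expl_D1 s' != set0].

(* The exploration started in state s ends with a valid graph partition.  The
   predicate is inductive, so a run that never covers U does not succeed. *)
Inductive expl_succeeds : expl_state T -> Prop :=
| expl_stop s :
    expl_cover s = U -> ~~ expl_reassigned s (expl_round s) ->
    expl_succeeds s
| expl_loop s :
    expl_cover s \proper U -> expl_disjoint (expl_round s) ->
    expl_succeeds (expl_round s) -> expl_succeeds s.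

(* The outcome is independent of the selected node when H is strongly
   connected; in general we ask for success from every selected node, so that
   the negation is that the exploration fails from some node. *)
Definition admits_graph_partition : Prop :=
  forall j, j \in U -> expl_succeeds (expl_init j).

End Exploration.

From mathcomp Require Import all_classical all_reals all_analysis.
Import numFieldNormedType.Exports.

Local Open Scope classical_set_scope.
Local Open Scope ring_scope.

Section Conditioning.
Context (d : measure_display) (Omega : measurableType d) (R : realType).
Variable P : probability Omega R.

(* Y is a version of the conditional probability P(E | G), for a
   sub-sigma-algebra G given as a set of events. *)
Definition is_cond_prob (G : set (set Omega)) (E : set Omega)
    (Y : Omega -> R) : Prop :=
  (forall C : set R, measurable C -> G (Y @^-1` C)) /\
  (forall A : set Omega, G A -> (\int[P]_(w in A) (Y w)%:E = P (A `&` E))%E).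

(* Given G, the variables (X i) are independent and X i is Bernoulli(p i); the
   case J = [set i], c i = true gives P(X i = 1 | G) = p i. *)
Definition cond_indep_bernoulli (G : set (set Omega)) (I : finType)
    (X : I -> Omega -> bool) (p : I -> Omega -> R) : Prop :=
  forall (J : {set I}) (c : I -> bool),
    is_cond_prob G [set w | forall i, i \in J -> X i w = c i]
      (fun w => \prod_(i in J) bernoulli_pmf (p i w) (c i)).

End Conditioning.

Section Urns.
Context (d : measure_display) (Omega : measurableType d) (R : realType).
Variables (P : probability Omega R) (N : nat).

Definition urn_fraction (W B : nat -> 'I_N -> Omega -> nat)
    (t : nat) (i : 'I_N) (w : Omega) : R :=
  (W t i w)%:R / (W t i w + B t i w)%:R.

(* sigma(Z^0, ..., Z^t) *)
Definition urn_filtration (Z : nat -> 'I_N -> Omega -> R) (t : nat) :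
    set (set Omega) :=
  <<s [set A | exists s i C,
         [/\ (s <= t)%N, measurable C & A = Z s i @^-1` C]] >>.

(* [chi t i] is the indicator of drawing white at node i at time t; only t >= 1
   is used.  In the recursion booleans are coerced to 0 or 1 and the
   subtractions are exact as soon as alpha j, beta j <= m j. *)
Record is_urn_process (e : rel 'I_N) (q : 'I_N -> R)
    (m alpha beta : 'I_N -> nat) (W0 B0 : 'I_N -> nat)
    (W B : nat -> 'I_N -> Omega -> nat) (chi : nat -> 'I_N -> Omega -> bool) :
    Prop := IsUrnProcess {
  urn_initW : forall i w, W 0%N i w = W0 i;
  urn_initB : forall i w, B 0%N i w = B0 i;
  urn_stepW : forall t i w, W t.+1 i w = (W t i w +
    \sum_(j in in_nbr e i) (alpha j * chi t.+1 j w
                            + (m j - beta j) * (1 - chi t.+1 j w)))%N;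
  urn_stepB : forall t i w, B t.+1 i w = (B t i w +
    \sum_(j in in_nbr e i) ((m j - alpha j) * chi t.+1 j w
                            + beta j * (1 - chi t.+1 j w)))%N;
  urn_chi_measurable : forall t i, measurable_fun setT (chi t.+1 i);
  urn_chi_law : forall t,
    cond_indep_bernoulli P (urn_filtration (urn_fraction W B) t) (chi t.+1)
      (fun i w => q i * urn_fraction W B t i w
                  + (1 - q i) * (1 - urn_fraction W B t i w)) }.

End Urns.

Definition polya_type (m alpha beta : nat) : bool :=
  (alpha == m) && (beta == m).

Definition non_polya_type (m alpha beta : nat) : bool :=
  (0 < alpha + beta < 2 * m)%N.

Section UrnMatrices.
Variables (R : realType) (N : nat) (e : rel 'I_N) (q : 'I_N -> R).
Variables (m alpha beta : 'I_N -> nat).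

Definition mbar (i : 'I_N) : nat := (\sum_(j in in_nbr e i) m j)%N.

Definition a_row : 'rV[R]_N := \row_i ((alpha i)%:R / (m i)%:R).

Definition b_row : 'rV[R]_N := \row_i ((beta i)%:R / (m i)%:R).

Definition q_row : 'rV[R]_N := \row_i q i.

Definition adj_mx : 'M[R]_N := \matrix_(i, j) (e i j)%:R.

Definition I_mx : 'M[R]_N := diag_mx (\row_i (2 * q i - 1)).

Definition B_mx : 'M[R]_N := diag_mx (\row_i (a_row 0 i + b_row 0 i - 1)).

Definition M_mx : 'M[R]_N := diag_mx (\row_i (m i)%:R).

Definition Mbar_inv_mx : 'M[R]_N :=
  diag_mx (\row_i if i \in flexible e then ((mbar i)%:R)^-1 else 0).

Definition Atilde_mx : 'M[R]_N := M_mx *m adj_mx *m Mbar_inv_mx.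

Definition IBA_mx : 'M[R]_N := I_mx *m B_mx *m Atilde_mx.

End UrnMatrices.

(* With the nodes labelled so that the flexible ones are the first nF of the
   nF + nS nodes, ulsubmx is Q_F, dlsubmx is Q_SF, and lsubmx, rsubmx restrict
   a row vector to F, S. *)
Definition Zstar_F (R : realType) (nF nS : nat) (e : rel 'I_(nF + nS))
    (q : 'I_(nF + nS) -> R) (m alpha beta : 'I_(nF + nS) -> nat)
    (Z0 : 'rV[R]_(nF + nS)) : 'rV[R]_nF :=
  let IBA := IBA_mx e q m alpha beta in
  let Atilde := Atilde_mx R e m in
  (rsubmx Z0 *m dlsubmx IBA
   + lsubmx (a_row R m alpha *m Atilde)
   - lsubmx (q_row q *m B_mx R m alpha beta *m Atilde))
  *m invmx (1%:M - ulsubmx IBA).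

(* Main.v *)
Require Import Defs.
From HB Require Import structures.
From mathcomp Require Import all_boot all_order all_algebra.
From mathcomp Require Import all_classical all_reals all_analysis.
From mathcomp Require Import measurable_realfun.
From mathcomp Require Import ring lra zify.
Import Order.TTheory GRing.Theory Num.Theory.
Import numFieldNormedType.Exports.

Set Implicit Arguments.
Unset Strict Implicit.
Unset Printing Implicit Defensive.

Local Open Scope ring_scope.

(** Stubborn urns never change.  On the flexible nodes, the number of white balls
    is its predictable drift plus a martingale [M] with bounded increments; since
    [E[M_t^2] = O(t)], summing [E[(M_t / t)^2]] along the squares [t = k^2] gives
    [M_t / t -> 0] almost surely, with no martingale convergence theorem.  What
    remains is deterministic: [y t], the distance of the fractions to the
    equilibrium, equals [f] of the mean of [y 0, ..., y (t - 1)] up to [o(1)],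
    where [f] multiplies by the flexible block of [I B Atilde].  This [f] does
    not increase the sup norm and [1 - f] is invertible, which forces the powers
    of [(1 + f) / 2] to contract, and hence the Cesaro means of [y], then [y]
    itself, to tend to [0].

    For the invertibility of [1 - f], a fixed vector of [f] has constant absolute
    value by the maximum principle and strong connectivity, which rules out
    conditions (i)-(iii); under (iv) its signs provide a valid graph partition:
    [P1] and [D2] carry one sign, [P2] and [D1] the other. *)

(** * A maximum principle on the flexible nodes *)

Section Graph.
Variables (T : finType) (e : rel T).

Lemma flexible_ex_in_nbr i : i \in flexible e -> exists j, e j i.
Proof.
by rewrite !inE => /set0Pn[j]; rewrite inE => eji; exists j.
Qed.

Lemma edge_flexible i j : e j i -> i \in flexible e.
Proof. by move=> eji; rewrite !inE; apply/set0Pn; exists j; rewrite inE. Qed.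

(** Carries a property against the edges along a path. It is applied to weak connectivity, to the
    maximisers of [|u|] and to the nodes covered by the exploration. *)
Lemma connect_backward_closed (r : rel T) (X : pred T) i j :
  (forall x y, r x y -> X y -> X x) -> connect r i j -> X j -> X i.
Proof.
move=> Xcl /connectP[p]; elim: p i => [|y p IH] i /=; first by move=> _ ->.
by move=> /andP[riy pth] jl Xj; apply: Xcl riy _; exact: IH pth jl Xj.
Qed.

Hypothesis F_strong : strongly_connected_on e (flexible e).

(** A path leads from [j] to one of its own in-neighbours [k]. Its first edge leaves [j]; if the
    path is empty, [k = j] carries a loop. *)
Lemma flexible_ex_out_nbr j : j \in flexible e ->
  (forall i k, e k i -> k \in flexible e) -> exists i, e j i.
Proof.
move=> jF Fcl; have [k ekj] := flexible_ex_in_nbr jF.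
have kF := Fcl _ _ ekj.
have /connectP[[|i p]] := F_strong jF kF.
  by move=> _ kj; exists j; move: ekj; rewrite kj.
by move=> /= /andP[/andP[_ eji] _] _; exists i.
Qed.

(** A node with an incoming edge is flexible, so under the closure hypothesis flexibility passes
    along edges in both directions, and weak connectivity spreads it everywhere. *)
Lemma stubborn_eq0 i0 : weakly_connected e -> i0 \in flexible e ->
  (forall i k, e k i -> k \in flexible e) -> stubborn e = finset.set0.
Proof.
move=> wc i0F Fcl; apply/setP => i; rewrite [RHS]inE; apply/negbTE.
suff: i \in flexible e by rewrite inE.
apply: connect_backward_closed (wc i i0) i0F => x y /= /orP[exy|eyx] _.
  exact: Fcl exy.
exact: edge_flexible eyx.
Qed.

Variable R : realFieldType.

Section MaximumPrinciple.
Variables (mass : T -> nat) (c u : T -> R).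
(** Convertible to [mbar e m] when [mass] is [m]; [in_mass_gt0] is later applied to [mbar] in this
    way. *)
Definition in_mass (i : T) : nat := (\sum_(j in in_nbr e i) mass j)%N.
Hypothesis mass_gt0 : forall j, (0 < mass j)%N.
Hypothesis c_le1 : forall j, `|c j| <= 1.
Hypothesis u_stubborn : forall i, i \notin flexible e -> u i = 0.
Hypothesis u_harmonic : forall i, i \in flexible e ->
  u i = (\sum_(j in in_nbr e i) u j * c j * (mass j)%:R) / (in_mass i)%:R.

Lemma in_mass_gt0 i : i \in flexible e -> (0 < in_mass i)%N.
Proof.
move=> /flexible_ex_in_nbr[j eji]; rewrite /in_mass (bigD1 j) ?inE//=.
by rewrite addn_gt0 mass_gt0.
Qed.

(** [u i] is a weighted mean of the numbers [u j * c j], none exceeding [|u i|] in absolute value; a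
    mean that attains the bound forces all of them to equal [u i]. *)
Lemma max_principle_step i j : (forall k, `|u k| <= `|u i|) -> u i != 0 ->
  e j i -> u j * c j = u i.
Proof.
move=> ui_max ui0 eji; have iF := edge_flexible eji.
pose s := Num.sg (u i).
have ss : s * s = 1 by rewrite /s -expr2 sqr_sg ui0.
(* The slack of each term, once [u i] is made positive by its sign [s]; the slacks add up to
   zero. *)
have term_ge0 k : k \in in_nbr e i ->
    0 <= (`|u i| - s * (u k * c k)) * (mass k)%:R.
  move=> _; rewrite mulr_ge0// subr_ge0 (le_trans (ler_norm _))//.
  rewrite !normrM /s normr_sg ui0 mul1r.
  by rewrite -[leRHS]mulr1 ler_pM.
have : \sum_(k in in_nbr e i) (`|u i| - s * (u k * c k)) * (mass k)%:R = 0.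
  under eq_bigr do rewrite mulrBl -mulrA.
  rewrite sumrB -mulr_sumr -mulr_sumr -natr_sum -/(in_mass i).
  have m0 : (in_mass i)%:R != 0 :> R by rewrite pnatr_eq0 -lt0n in_mass_gt0.
  have /(congr1 (fun x => x * (in_mass i)%:R)) := u_harmonic iF.
  rewrite divfK// => <-.
  by rewrite mulrA /s -normrEsg subrr.
move/eqP; rewrite psumr_eq0// => /allP/(_ j); rewrite mem_index_enum => /(_ isT).
rewrite inE eji /= mulf_eq0 pnatr_eq0 (gtn_eqF (mass_gt0 j)) orbF subr_eq0.
move=> /eqP/(congr1 (fun x => s * x)); rewrite mulrA ss mul1r => <-.
by rewrite /s -numEsg.
Qed.

(** By [max_principle_step] the maximisers of [|u|] are closed under in-neighbours. One of them is
    flexible, as [u] vanishes elsewhere, so strong connectivity makes every flexible node a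
    maximiser; comparing absolute values across an edge then gives [|c j| = 1]. *)
Lemma max_principle i0 : u i0 != 0 ->
  (forall i j, e j i -> [/\ u j * c j = u i, `|c j| = 1 & u j != 0]) /\
  (forall i, i \in flexible e -> u i != 0).
Proof.
move=> ui0.
have [i uimax] : exists i, forall k, `|u k| <= `|u i|.
  have [i _ imax] := @arg_maxP _ _ _ i0 xpredT (fun k => `|u k|) isT.
  by exists i => k; exact: imax.
have uin0 : u i != 0 by rewrite -normr_gt0 (lt_le_trans _ (uimax i0))// normr_gt0.
pose X k := `|u k| == `|u i|.
have Xmax k : X k -> (forall l, `|u l| <= `|u k|) /\ u k != 0.
  by move=> /eqP uk; split=> [l|]; [rewrite uk|rewrite -normr_gt0 uk normr_gt0].
have Xcl x y : e x y -> X y -> X x.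
  move=> exy Xy; have [ymax uy0] := Xmax _ Xy.
  have := max_principle_step ymax uy0 exy.
  move=> /(congr1 Num.norm); rewrite normrM (eqP Xy) => uxc.
  rewrite /X eq_le uimax/= -uxc -[leRHS]mulr1 ler_pM//.
have iF : i \in flexible e by apply: contraNT uin0 => /u_stubborn ->.
have XF k : k \in flexible e -> X k.
  move=> kF; apply: (connect_backward_closed (X := X)) (F_strong kF iF) _.
    by move=> x y /andP[_]; exact: Xcl.
  exact: eqxx.
split=> [k j ejk|k kF]; last by have [] := Xmax _ (XF _ kF).
have Xk := XF _ (edge_flexible ejk).
have [kmax uk0] := Xmax _ Xk; have Xj := Xcl _ _ ejk Xk.
have [_ uj0] := Xmax _ Xj; have ujk := max_principle_step kmax uk0 ejk.
split=> //; apply: (@mulfI _ `|u j|); rewrite ?normr_eq0//.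
by rewrite -normrM ujk (eqP Xk) (eqP Xj) mulr1.
Qed.

End MaximumPrinciple.

End Graph.

(** * Signed colourings and the exploration process *)

Section SignedPartition.
Variables (T : finType) (e : rel T) (U Pr De : {set T}) (sigma : T -> bool).
Hypothesis U_strong : strongly_connected_on e U.
Hypothesis PrDe_cover : Pr :|: De = U.
Hypothesis PrDe_disjoint : [disjoint Pr & De].
Hypothesis sigmaP : forall i j, i \in U -> j \in U -> e j i ->
  sigma j = (if j \in Pr then sigma i else ~~ sigma i).

Let notin_Pr j : j \in De -> (j \in Pr) = false.
Proof. by move=> jD; apply: (disjointFl PrDe_disjoint). Qed.

Let Pr_sub j : j \in Pr -> j \in U.
Proof. by move=> jP; rewrite -PrDe_cover inE jP. Qed.

Let De_sub j : j \in De -> j \in U.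
Proof. by move=> jD; rewrite -PrDe_cover inE jD orbT. Qed.

(** [b] is the sign of [P1] and [D2]. Crossing an edge backwards flips the sign exactly when its
    tail is de-preferential, and the four updates follow the same rule. *)
Definition signed_state (b : bool) (s : expl_state T) : Prop :=
  [/\ expl_P1 s \subset [set i in Pr | sigma i == b],
      expl_P2 s \subset [set i in Pr | sigma i != b],
      expl_D1 s \subset [set i in De | sigma i != b] &
      expl_D2 s \subset [set i in De | sigma i == b]].

Lemma sub_in_nbrs_Pr (X Y : {set T}) (b : bool) :
  X \subset [set i in U | sigma i == b] -> Y \subset [set i in Pr | sigma i == b] ->
  Y :|: in_nbrs e U X :&: Pr \subset [set i in Pr | sigma i == b].
Proof.
move=> /fintype.subsetP XU YP; rewrite finset.subUset YP; apply/fintype.subsetP => j.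
rewrite !inE => /andP[/bigcupP[i iX]]; rewrite !inE => /andP[eji jU] jP.
have := XU _ iX; rewrite inE => /andP[iU /eqP sib].
by rewrite jP (sigmaP iU jU eji) jP sib eqxx.
Qed.

Lemma sub_in_nbrs_De (X Y : {set T}) (b : bool) :
  X \subset [set i in U | sigma i == b] -> Y \subset [set i in De | sigma i == ~~ b] ->
  Y :|: in_nbrs e U X :&: De \subset [set i in De | sigma i == ~~ b].
Proof.
move=> /fintype.subsetP XU YP; rewrite finset.subUset YP; apply/fintype.subsetP => j.
rewrite !inE => /andP[/bigcupP[i iX]]; rewrite !inE => /andP[eji jU] jD.
have := XU _ iX; rewrite inE => /andP[iU /eqP sib].
by rewrite jD (sigmaP iU jU eji) notin_Pr// sib eqxx.
Qed.

Let sub_U (A : {set T}) (p : pred T) : {subset A <= U} ->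
  [set i in A | p i] \subset [set i in U | p i].
Proof.
by move=> AU; apply/fintype.subsetP => i; rewrite !inE => /andP[/AU -> ->].
Qed.

Lemma signed_state_round b s : signed_state b s -> signed_state b (expl_round e U Pr De s).
Proof.
(* With [!= b] turned into [== ~~ b], the two lemmas on in-neighbours serve both signs. The primed
   sets below are the intermediate values within the round. *)
have neqE (X : {set T}) : [set i in X | sigma i != b] = [set i in X | sigma i == ~~ b].
  by apply/setP => i; rewrite !inE; case: b (sigma i) => -[].
rewrite /signed_state !neqE; case: s => P1 P2 D1 D2 /=; move=> [hP1 hP2 hD1 hD2].
have toU (A X : {set T}) c : {subset A <= U} -> X \subset [set i in A | sigma i == c] ->
    X \subset [set i in U | sigma i == c].
  by move=> AU /fintype.subset_trans; apply; exact: sub_U.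
set D1' := D1 :|: _; set P1' := P1 :|: _.
have h1P : P1' \subset [set i in Pr | sigma i == b].
  by apply: sub_in_nbrs_Pr => //; apply: toU hP1.
have h1D : D1' \subset [set i in De | sigma i == ~~ b].
  by apply: sub_in_nbrs_De => //; apply: toU hP1.
set P2' := P2 :|: _; set D2' := D2 :|: _.
have h2P : P2' \subset [set i in Pr | sigma i == ~~ b].
  by apply: sub_in_nbrs_Pr => //; apply: toU h1D.
have h2D : D2' \subset [set i in De | sigma i == b].
  by rewrite -[b]negbK; apply: sub_in_nbrs_De; rewrite ?negbK//; apply: toU h1D.
have h3P : P1' :|: in_nbrs e U D2' :&: Pr \subset [set i in Pr | sigma i == b].
  by apply: sub_in_nbrs_Pr => //; apply: toU h2D.
have h3D : D1' :|: in_nbrs e U D2' :&: De \subset [set i in De | sigma i == ~~ b].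
  by apply: sub_in_nbrs_De => //; apply: toU h2D.
split => //.
  by apply: sub_in_nbrs_Pr => //; apply: toU h2P.
by rewrite -[b]negbK; apply: sub_in_nbrs_De; rewrite ?negbK//; apply: toU h2P.
Qed.

Let disjoint_sigma (A X Y : {set T}) b : X \subset [set i in A | sigma i == b] ->
  Y \subset [set i in A | sigma i != b] -> [disjoint X & Y].
Proof.
move=> XA YA; apply: disjointWl XA _; apply: disjointWr YA _.
by apply/pred0P => i /=; rewrite !inE; case: (sigma i == b); rewrite ?andbF.
Qed.

Let disjoint_PrDe (X Y : {set T}) (p p' : pred T) : X \subset [set i in Pr | p i] ->
  Y \subset [set i in De | p' i] -> [disjoint X & Y].
Proof.
move=> XA YA; apply: disjointWl XA _; apply: disjointWr YA _.
apply/pred0P => i /=; rewrite !inE.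
by have [iP|//] := boolP (i \in Pr); rewrite (disjointFr PrDe_disjoint iP) /= andbF.
Qed.

Lemma signed_state_disjoint b s : signed_state b s -> expl_disjoint s.
Proof.
case: s => P1 P2 D1 D2 [/= hP1 hP2 hD1 hD2]; apply/and5P; split.
- exact: disjoint_sigma hP1 hP2.
- exact: disjoint_PrDe hP1 hD1.
- exact: disjoint_PrDe hP1 hD2.
- exact: disjoint_PrDe hP2 hD1.
- by rewrite (disjoint_PrDe hP2 hD2) disjoint_sym (disjoint_sigma hD2 hD1).
Qed.

(** Both states respect the same signs, so [P1] of one cannot meet [P2] of the other, and likewise
    for [D1] and [D2]. *)
Lemma signed_state_not_reassigned b s s' :
  signed_state b s -> signed_state b s' -> ~~ expl_reassigned s s'.
Proof.
case: s s' => P1 P2 D1 D2 [Q1 Q2 E1 E2] [/= hP1 hP2 hD1 hD2] [/= hQ1 hQ2 hE1 hE2].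
rewrite /expl_reassigned /= !finset.setI_eq0 !negb_or !negbK.
rewrite (disjoint_sigma hP1 hQ2) (disjoint_sigma hD2 hE1) ?andbT.
by rewrite disjoint_sym (disjoint_sigma hQ1 hP2) disjoint_sym (disjoint_sigma hE2 hD1).
Qed.

Lemma signed_state_cover_sub b s : signed_state b s -> expl_cover s \subset U.
Proof.
case: s => P1 P2 D1 D2 [/= hP1 hP2 hD1 hD2]; rewrite /expl_cover !finset.subUset /=.
apply/andP; split; first (apply/andP; split; first (apply/andP; split)).
- by apply: fintype.subset_trans hP1 _; apply/fintype.subsetP => i; rewrite inE => /andP[/Pr_sub].
- by apply: fintype.subset_trans hP2 _; apply/fintype.subsetP => i; rewrite inE => /andP[/Pr_sub].
- by apply: fintype.subset_trans hD1 _; apply/fintype.subsetP => i; rewrite inE => /andP[/De_sub].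
- by apply: fintype.subset_trans hD2 _; apply/fintype.subsetP => i; rewrite inE => /andP[/De_sub].
Qed.

(** Each of the four sets has its in-neighbours added by one of the updates, at a stage where it can
    only have grown, and each in-neighbour lies in [Pr] or in [De]. *)
Lemma expl_cover_round s : expl_cover s :|: in_nbrs e U (expl_cover s)
  \subset expl_cover (expl_round e U Pr De s).
Proof.
case: s => P1 P2 D1 D2; rewrite /expl_cover /=.
apply/fintype.subsetP => j; rewrite inE => /orP[|].
  by rewrite !inE => /orP[/orP[/orP[]|]|] ->; rewrite ?orbT.
move=> /bigcupP[i iX jN].
have jU : j \in U by move: jN; rewrite inE => /andP[].
have inN (X : {set T}) : i \in X -> j \in in_nbrs e U X.
  by move=> iX'; apply/bigcupP; exists i.
have jPD : (j \in Pr) || (j \in De) by rewrite -finset.in_setU PrDe_cover.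
set D1' := D1 :|: _; set P1' := P1 :|: _; set P2' := P2 :|: _; set D2' := D2 :|: _.
have oneof (X : {set T}) : i \in X ->
    (j \in in_nbrs e U X :&: Pr) || (j \in in_nbrs e U X :&: De).
  by move=> /inN jX; rewrite !(finset.in_setI, jX).
move: iX; rewrite !finset.in_setU => /orP[/orP[/orP[]|]|] /=.
- by move=> /oneof/orP[] ->; rewrite ?orbT.
- move=> iP2; have iY : i \in P2' by rewrite finset.in_setU iP2.
  have /orP[h|h] := oneof _ iY.
    by rewrite h ?orbT.
  by rewrite h ?orbT.
- move=> iD1; have iY : i \in D1' by rewrite finset.in_setU iD1.
  have /orP[h|h] := oneof _ iY.
    by rewrite h ?orbT.
  by rewrite h ?orbT.
- move=> iD2; have iY : i \in D2' by rewrite finset.in_setU iD2.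
  have /orP[h|h] := oneof _ iY.
    by rewrite h ?orbT.
  by rewrite h ?orbT.
Qed.

(** If a round added nothing, the covered set would be closed under in-neighbours inside [U], and
    strong connectivity would make it all of [U]. *)
Lemma expl_cover_grows s j : j \in expl_cover s -> expl_cover s \proper U ->
  expl_cover s \proper expl_cover (expl_round e U Pr De s).
Proof.
move=> jX /properP[XU [k kU kX]].
rewrite properE (fintype.subset_trans _ (expl_cover_round s)) ?finset.subsetUl//=.
apply: contra kX => hX.
have {}hX : in_nbrs e U (expl_cover s) \subset expl_cover s.
  apply: fintype.subset_trans hX; apply: fintype.subset_trans (expl_cover_round s).
  exact: finset.subsetUr.
apply: (connect_backward_closed (X := mem (expl_cover s)))
  (U_strong kU (fintype.subsetP XU _ jX)) jX.
move=> x y /andP[/andP[xU _] exy] yX; apply: (fintype.subsetP hX).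
by apply/bigcupP; exists y => //; rewrite !inE exy xU.
Qed.

(** Induction on the number of uncovered nodes: the sign invariant passes the disjointness and
    reassignment tests, and each round covers more. *)
Lemma signed_expl_succeeds b s j : signed_state b s -> j \in expl_cover s ->
  expl_succeeds e U Pr De s.
Proof.
have [n] := ubnP (#|U| - #|expl_cover s|)%N.
elim: n s => // n IH s ltn inv jX.
have [XU|XnU] := eqVneq (expl_cover s) U.
  apply: expl_stop => //; apply: (signed_state_not_reassigned inv).
  exact: signed_state_round.
have XpU : expl_cover s \proper U by rewrite finset.properEneq XnU (signed_state_cover_sub inv).
have inv' := signed_state_round inv.
have grow := expl_cover_grows jX XpU.
apply: expl_loop => //; first exact: signed_state_disjoint inv'.
apply: (IH _ _ inv'); last exact: (fintype.subsetP (proper_sub grow)).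
have := proper_card grow; have := proper_card XpU.
have := subset_leq_card (signed_state_cover_sub inv').
by move: ltn; lia.
Qed.

Lemma signed_graph_partition : admits_graph_partition e U Pr De.
Proof.
move=> j jU; rewrite /expl_init; case: ifPn => jP.
  apply: (@signed_expl_succeeds (sigma j) _ j); last by rewrite /expl_cover !inE eqxx.
  by split; rewrite ?finset.sub1set ?finset.sub0set// inE jP eqxx.
have jD : j \in De by move: jU; rewrite -PrDe_cover inE (negbTE jP).
(* [D1] carries the sign opposite to [b], hence the negation. *)
apply: (@signed_expl_succeeds (~~ sigma j) _ j); last by rewrite /expl_cover !inE eqxx !orbT.
by split; rewrite ?finset.sub1set ?finset.sub0set// inE jD; case: (sigma j).
Qed.

End SignedPartition.

Local Open Scope classical_set_scope.

(** * Recursions driven by their own Cesaro means *)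

Section HalfStepContraction.
Variables (R : realType) (V : normedModType R) (f : {linear V -> V}) (K : R).
Hypothesis K_ge0 : 0 <= K.
Hypothesis f_le : forall v, `|f v| <= `|v|.
Hypothesis f_gap : forall v, `|v| <= K * `|v - f v|.

(** The lazy version of [f]: eigenvalues of modulus one other than [1] are damped. It appears in the
    recursion of the Cesaro means through [v + f v]. *)
Definition half_step (v : V) : V := 2^-1 *: (v + f v).

Lemma half_stepD u v : half_step (u + v) = half_step u + half_step v.
Proof. by rewrite /half_step (linearD f) addrACA scalerDr. Qed.

Lemma half_stepZ a v : half_step (a *: v) = a *: half_step v.
Proof. by rewrite /half_step (linearZZ f) -scalerDr !scalerA mulrC. Qed.

Lemma half_step_le v : `|half_step v| <= `|v|.
Proof.
rewrite normrZ ger0_norm// ler_pdivrMl// mulrC mulrDr mulr1.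
by rewrite (le_trans (ler_normD _ _))// lerD.
Qed.

(** [1 - f] telescopes on this sum, so [f_gap] bounds its norm by [2 * K * |v|] for every [n],
    whereas the triangle inequality only gives [n * |v|]. *)
Let orbit_sum n v := \sum_(k < n) iter k f v.

Let iter_le k v : `|iter k f v| <= `|v|.
Proof. by elim: k => //= k IH; exact: le_trans (f_le _) IH. Qed.

Let orbit_sum_le n v : `|orbit_sum n v| <= n%:R * `|v|.
Proof.
rewrite (le_trans (ler_norm_sum _ _ _))//.
apply: (@le_trans _ _ (\sum_(k < n) `|v|)); first by apply: ler_sum => k _; exact: iter_le.
by rewrite sumr_const card_ord mulr_natl.
Qed.

Let f_orbit_sum n v : orbit_sum n.+1 v = v + f (orbit_sum n v).
Proof. by rewrite /orbit_sum big_ord_recl/= (linear_sum f). Qed.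

Let orbit_sumS n v : orbit_sum n.+1 v = orbit_sum n v + iter n f v.
Proof. by rewrite /orbit_sum big_ord_recr. Qed.

(* [half_step^n = 2^-n sum_k 'C(n, k) f^k]; every coefficient is at least
   [2^-n], and subtracting this much from each leaves total mass
   [1 - (n + 1) 2^-n]. *)
Lemma iter_half_step_near_sum n v :
  `|iter n half_step v - 2^-1 ^+ n *: orbit_sum n.+1 v|
    <= (1 - n.+1%:R * 2^-1 ^+ n) * `|v|.
Proof.
elim: n => [|n IH] /=.
  by rewrite /orbit_sum big_ord1 expr0 scale1r subrr normr0 mul1r subrr mul0r.
set p : R := 2^-1 ^+ n in IH *.
have p0 : 0 <= p by rewrite exprn_ge0// invr_ge0.
set r := _ - _ in IH.
have -> : iter n half_step v = r + p *: orbit_sum n.+1 v by rewrite subrK.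
rewrite half_stepD half_stepZ exprS -/p.
(* With [S n] for [orbit_sum n v], [v + f (S n.+1)] is [S n.+2] and [f (S n)] is left over, of norm
   at most [n * |v|]. The new bound is then [1 - (n + 1) p + n p / 2 = 1 - (n + 2) p / 2]. *)
have -> : half_step (orbit_sum n.+1 v)
    = 2^-1 *: (orbit_sum n.+2 v + f (orbit_sum n v)).
  by rewrite /half_step f_orbit_sum (linearD f) (f_orbit_sum n.+1) f_orbit_sum (linearD f) addrAC.
rewrite scalerA [p * _]mulrC scalerDr -addrA [X in _ + X]addrAC subrr add0r.
rewrite (le_trans (ler_normD _ _))// [X in _ + X]normrZ (@ger0_norm _ (2^-1 * p)) ?mulr_ge0//.
have fS : `|f (orbit_sum n v)| <= n%:R * `|v|.
  exact: le_trans (f_le _) (orbit_sum_le _ _).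
have gr := le_trans (half_step_le r) IH.
rewrite (le_trans (lerD gr (ler_wpM2l _ fS)))// ?mulr_ge0//.
rewrite [n.+2%:R]mulrS [n.+1%:R]mulrS le_eqVlt.
by apply/orP; left; apply/eqP; field.
Qed.

(** The orbit sum contributes at most [2 K p] instead of its mass [(n + 2) p], a strict gain as soon
    as [n + 2 > 2 K]. *)
Lemma iter_half_step_contracts : exists n theta, 0 <= theta < 1 /\
  forall v, `|iter n.+1 half_step v| <= theta * `|v|.
Proof.
have [n nK] : exists n, 2 * K <= n%:R.
  exists (Num.truncn `|2 * K|).+1.
  by rewrite (le_trans (ler_norm _))// ltW// truncnS_gt.
pose p : R := 2^-1 ^+ n.+1.
have p0 : 0 < p by rewrite exprn_gt0.
(* The maximum with [0] makes nonnegativity of [theta] immediate. *)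
exists n, (Num.max 0 (1 - (n.+2%:R - 2 * K) * p)); split.
  rewrite le_max lexx/= gt_max ltr01/= ltrBlDr ltrDl mulr_gt0// subr_gt0.
  by rewrite (le_lt_trans nK)// ltr_nat.
move=> v; have gap : `|orbit_sum n.+2 v| <= K * (`|v| + `|v|).
  have /le_trans := f_gap (orbit_sum n.+2 v); apply.
  rewrite ler_wpM2l//.
  have -> : orbit_sum n.+2 v - f (orbit_sum n.+2 v) = v - iter n.+2 f v.
    by apply/eqP; rewrite subr_eq addrAC eq_sym subr_eq -f_orbit_sum orbit_sumS.
  by rewrite (le_trans (ler_normB _ _))// lerD.
have := iter_half_step_near_sum n.+1 v.
rewrite -/p => near; rewrite -[X in `|X|](subrK (p *: orbit_sum n.+2 v)).
rewrite (le_trans (ler_normD _ _))// (le_trans (lerD near (lexx _)))//.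
rewrite normrZ (ger0_norm (ltW p0)).
rewrite (le_trans (lerD (lexx _) (ler_wpM2l (ltW p0) gap)))//.
rewrite [leLHS](_ : _ = (1 - (n.+2%:R - 2 * K) * p) * `|v|); last by ring.
by rewrite ler_wpM2r// le_max lexx orbT.
Qed.

Lemma iter_half_stepD k u v :
  iter k half_step (u + v) = iter k half_step u + iter k half_step v.
Proof. by elim: k => //= k ->; rewrite half_stepD. Qed.

Lemma iter_half_stepZ k a v : iter k half_step (a *: v) = a *: iter k half_step v.
Proof. by elim: k => //= k ->; rewrite half_stepZ. Qed.

Lemma iter_half_step_le k v : `|iter k half_step v| <= `|v|.
Proof. by elim: k => //= k IH; exact: le_trans (half_step_le _) IH. Qed.

(** An adapted norm: [phi] sums the norms of the first [n + 1] iterates. Applying [half_step] trades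
    the term [|v|] for one of size at most [theta * |v|], and [|v|] is at least
    [phi v / (n + 1)]. *)
Lemma exists_contracted_norm : exists (phi : V -> R) (n rho : R),
  [/\ 0 <= n, rho < 1,
      forall v, `|v| <= phi v <= n * `|v|,
      forall a u v, phi (a *: u + v) <= `|a| * phi u + phi v &
      forall v, phi (half_step v) <= rho * phi v].
Proof.
have [n [theta [/andP[theta0 theta1] contr]]] := iter_half_step_contracts.
pose phi v := \sum_(k < n.+1) `|iter k half_step v|.
have phi_le v : phi v <= n.+1%:R * `|v|.
  apply: (@le_trans _ _ (\sum_(k < n.+1) `|v|)).
    by apply: ler_sum => k _; exact: iter_half_step_le.
  by rewrite sumr_const card_ord mulr_natl.
exists phi, n.+1%:R, (1 - (1 - theta) / n.+1%:R); split => //.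
- by rewrite ltrBlDr ltrDl divr_gt0// subr_gt0.
- move=> v; rewrite phi_le andbT /phi big_ord_recl/= lerDl.
  by apply: sumr_ge0.
- move=> a u v; rewrite /phi mulr_sumr -big_split/=; apply: ler_sum => k _.
  by rewrite iter_half_stepD iter_half_stepZ (le_trans (ler_normD _ _))// normrZ.
- move=> v; have -> : phi (half_step v) = phi v - `|v| + `|iter n.+1 half_step v|.
    rewrite /phi big_ord_recr [in RHS]big_ord_recl /= [`|v| + _]addrC addrK -iterSr.
    by congr (_ + _); apply: eq_bigr => k _; rewrite -iterSr.
  rewrite -addrA (le_trans (lerD (lexx _) (lerD (lexx _) (contr v))))//.
  rewrite mulrBl mul1r lerD2l -mulrA lerNr opprD opprK -[X in X - _]mul1r -mulrBl.
  by rewrite ler_wpM2l ?subr_ge0 ?(ltW theta1)// mulrC ler_pdivrMr// mulrC.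
Qed.
End HalfStepContraction.

(** * Relaxation of the Cesaro means *)

Section Averaging.
Variable R : realType.

Lemma cvg0_le_normP (V : normedModType R) (u : nat -> V) :
  u @ \oo --> 0 <-> forall eps, 0 < eps -> exists n0, forall n, (n0 <= n)%N -> `|u n| <= eps.
Proof.
split=> [/cvgrPdist_le u0 eps /u0[n0 _ h]|u0].
  by exists n0 => n /h; rewrite /= sub0r normrN.
apply/cvgrPdist_le => eps /u0[n0 h]; exists n0 => // n /= /h.
by rewrite sub0r normrN.
Qed.

(* Discrete Gronwall at the time scale [log t], where [sum 1/t] diverges. *)
Lemma harmonic_relaxation (c : R) (u b : nat -> R) :
  0 < c -> (forall t, 0 <= u t) -> b @ \oo --> 0 ->
  (exists t0, forall t, (t0 <= t)%N ->
     u t.+1 <= (1 - c / t.+1%:R) * u t + b t / t.+1%:R) ->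
  u @ \oo --> 0.
Proof.
move=> c0 u0 /cvg0_le_normP b0 [t0 urec]; apply/cvg0_le_normP => eps eps0.
(* At [u t = eps] the relaxation removes [c * eps / (t + 1)]; the perturbation is kept below half of
   that. *)
have [t1 bt1] : exists t1, forall t, (t1 <= t)%N -> `|b t| <= c * eps / 2.
  by apply: b0; rewrite divr_gt0// mulr_gt0.
pose t2 := maxn (maxn t0 t1) (Num.truncn c).
have step t : (t2 <= t)%N ->
    [/\ 0 <= 1 - c / t.+1%:R &
        u t.+1 <= (1 - c / t.+1%:R) * u t + c * eps / 2 / t.+1%:R].
  rewrite !geq_max -andbA => /and3P[t0t t1t ct]; split.
    rewrite subr_ge0 ler_pdivrMr// mul1r (le_trans (ltW (truncnS_gt _)))//.
    by rewrite ler_nat.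
  rewrite (le_trans (urec _ t0t))// lerD2l ler_wpM2r//.
  exact: le_trans (ler_norm _) (bt1 _ t1t).
have stay t : (t2 <= t)%N -> u t <= eps -> u t.+1 <= eps.
  move=> /step[ct /le_trans] h ut; apply: h.
  rewrite (le_trans (lerD (ler_wpM2l ct ut) (lexx _)))//.
  rewrite [leLHS](_ : _ = eps - c * eps / 2 / t.+1%:R); last by field; rewrite addrC natr1.
  by rewrite gerBl !mulr_ge0 ?invr_ge0// ltW.
(* Were [u] to stay above [eps], each step would lose at least [a / (t + 1)]; as [u] is nonnegative,
   this would bound the harmonic series. *)
have [t3 t23 ut3] : exists2 t3, (t2 <= t3)%N & u t3 <= eps.
  apply: contrapT => /forall2NP never.
  have above t : (t2 <= t)%N -> eps < u t.
    by move=> t2t; have [//|/negP] := never t; rewrite -ltNge.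
  pose a := c * eps / 2.
  have a0 : 0 < a by rewrite divr_gt0// mulr_gt0.
  have decr k : a * (series (@harmonic R) (t2 + k)%N - series harmonic t2)
      <= u t2 - u (t2 + k)%N.
    elim: k => [|k IH]; first by rewrite addn0 !subrr mulr0.
    have t2k : (t2 <= t2 + k)%N by rewrite leq_addr.
    have [ct ut] := step _ t2k.
    have := above _ t2k => /ltW epsu.
    have h0 : 0 <= (t2 + k).+1%:R^-1 :> R by rewrite invr_ge0.
    have gain : 0 <= c * (t2 + k).+1%:R^-1 * (u (t2 + k)%N - eps).
      by rewrite !mulr_ge0 ?subr_ge0// ltW.
    rewrite addnS seriesS /=; move: gain ut IH; rewrite /a.
    move: (_ %:R^-1) (series harmonic (t2 + k)%N) (series harmonic t2) => h x x'.
    by move: (u _) (u _) (u _) => v v' v''; nra.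
  apply: (@dvg_harmonic R).
  apply: (@near_nondecreasing_is_cvgn _ _ (u t2 / a + series harmonic t2)).
    by apply: nearW; apply/nondecreasing_series => k _ _; exact: harmonic_ge0.
  exists t2 => // n /= t2n; have := decr (n - t2)%N; rewrite subnKC// => hn.
  rewrite -lerBlDr ler_pdivlMr// mulrC (le_trans hn)// gerDl.
  by rewrite oppr_le0.
exists t3 => n; rewrite ger0_norm//; elim: n => [|n IH].
  by rewrite leqn0 => /eqP t30; rewrite -t30.
rewrite leq_eqVlt => /predU1P[<-//|]; rewrite ltnS => t3n.
by apply: stay; [exact: leq_trans t3n|exact: IH].
Qed.

(** The means satisfy [(t + 1) A t.+1 = (t - 1) A t + 2 half_step (A t) + r t], so [phi (A t)]
    relaxes at rate [2 (1 - rho) / (t + 1)]. Then [y = f A + r] tends to [0] as well. *)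
Lemma averaged_recursion_cvg0 (V : normedModType R) (f : {linear V -> V}) (K : R)
    (y : nat -> V) :
  (forall v, `|f v| <= `|v|) -> 0 <= K -> (forall v, `|v| <= K * `|v - f v|) ->
  (fun t => y t - f (t%:R^-1 *: \sum_(s < t) y s)) @ \oo --> 0 ->
  y @ \oo --> 0.
Proof.
move=> f_le K0 f_gap r0; pose A t := t%:R^-1 *: \sum_(s < t) y s.
pose r t := y t - f (A t); have {}r0 : r @ \oo --> 0 by [].
have [phi [n [rho [n0 rho1 phi_norm phi_cvx phi_half]]]] :=
  exists_contracted_norm K0 f_le f_gap.
have phi_ge0 v : 0 <= phi v.
  by have /andP[h _] := phi_norm v; exact: le_trans (normr_ge0 _) h.
have AS t : (0 < t)%N ->
    A t.+1 = ((t.-1)%:R / t.+1%:R) *: A t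
             + ((2 / t.+1%:R) *: half_step f (A t) + t.+1%:R^-1 *: r t).
  move=> t0; rewrite {1}/A big_ord_recr/=.
  have -> : \sum_(s < t) y s = t%:R *: A t.
    by rewrite scalerA divff ?scale1r// pnatr_eq0 -lt0n.
  have -> : y t = f (A t) + r t by rewrite addrC subrK.
  move: (A t) (r t) => a b.
  rewrite /half_step !scalerDr !scalerA !addrA; congr (_ + _).
  rewrite -scalerDl; congr (_ *: _ + _ *: _).
    have -> : t.-1%:R = t%:R - 1 :> R by rewrite -[in RHS](prednK t0) -natr1 addrK.
    by field; rewrite addrC natr1.
  by field; rewrite addrC natr1.
have phiA : phi \o A @ \oo --> 0.
  apply: (@harmonic_relaxation (2 * (1 - rho)) _ (fun t => n * `|r t|)) => //.
  - by rewrite mulr_gt0// subr_gt0.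
  - by move=> t /=.
  - by rewrite -[X in _ --> X](mulr0 n); apply: cvgMr; rewrite -(@normr0 _ V); exact: cvg_norm.
  (* From [t = 1] on, the coefficient [t - 1] is nonnegative and the conventional value [0^-1 = 0]
     in [A 0] is avoided. *)
  - exists 1%N => t t1 /=; rewrite AS//.
    rewrite (le_trans (phi_cvx _ _ _))// ger0_norm//.
    have : phi ((2 / t.+1%:R) *: half_step f (A t) + t.+1%:R^-1 *: r t)
        <= 2 / t.+1%:R * (rho * phi (A t)) + t.+1%:R^-1 * (n * `|r t|).
      rewrite (le_trans (phi_cvx _ _ _))// ger0_norm//.
      rewrite lerD ?ler_wpM2l//.
      have /andP[_] := phi_norm (t.+1%:R^-1 *: r t).
      by rewrite normrZ ger0_norm// mulrCA.
    move=> h; rewrite (le_trans (lerD (lexx _) h))// le_eqVlt; apply/orP; left.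
    have -> : t.-1%:R = t.+1%:R - 2 :> R by rewrite -[t](prednK t1) -!natr1 /=; ring.
    by apply/eqP; field; rewrite addrC natr1.
have A0 : A @ \oo --> 0.
  apply/cvg0_le_normP => eps /(proj1 (cvg0_le_normP _) phiA)[n1 h].
  exists n1 => t /h; rewrite /= ger0_norm//; apply: le_trans.
  by have /andP[] := phi_norm (A t).
have -> : y = (fun t => f (A t) + r t) by apply/funext => t; rewrite addrC subrK.
rewrite -[X in _ --> X]addr0; apply: cvgD => //.
apply/cvg0_le_normP => eps /(proj1 (cvg0_le_normP _) A0)[n1 h].
by exists n1 => t /h; exact: le_trans.
Qed.
End Averaging.

(** * A law of large numbers for orthogonal increments *)

Lemma exists_square_bracket t : (0 < t)%N -> exists k, (k.+1 ^ 2 <= t < k.+2 ^ 2)%N.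
Proof.
elim: t => // -[_ _|t /(_ isT)[k /andP[kt tk]] _]; first by exists 0%N.
have [h|h] := ltnP t.+2 (k.+2 ^ 2); first by exists k; rewrite h (leq_trans kt).
exists k.+1; rewrite h (leq_ltn_trans tk)// ltn_exp2r//.
Qed.

Section OrthogonalIncrements.
Context (d : measure_display) (Omega : measurableType d) (R : realType).

(** The series of the squares has finite integral, so it converges almost everywhere and its terms
    vanish in the limit. *)
Lemma summable_squares_cvg0 (mu : {measure set Omega -> \bar R})
    (X : nat -> Omega -> R) (b : R) :
  (forall k, measurable_fun setT (X k)) ->
  (forall n, (\sum_(0 <= k < n) \int[mu]_w ((X k w) ^+ 2)%:E <= b%:E)%E) ->
  {ae mu, forall w, X ^~ w @ \oo --> 0}.
Proof.
move=> mX Xb; pose f (k : nat) (w : Omega) : \bar R := ((X k w) ^+ 2)%:E.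
have mf k : measurable_fun setT (f k).
  by apply/measurable_EFinP; apply: measurable_funX; exact: mX.
have f0 k w : (0 <= f k w)%E by rewrite lee_fin sqr_ge0.
pose g (w : Omega) : \bar R := (\sum_(k <oo) f k w)%E.
have g0 w : (0 <= g w)%E by apply: nneseries_ge0 => k _ _; exact: f0.
have intg : (\int[mu]_w g w <= b%:E)%E.
  rewrite integral_nneseries//; apply: lime_le.
    by apply: is_cvg_nneseries => k _ _; apply: integral_ge0 => w _; exact: f0.
  by apply: nearW => n; exact: Xb.
have mg : measurable_fun setT g.
  by apply: ge0_emeasurable_sum => // k w _ _; exact: f0.
have /integrable_ae : mu.-integrable setT g.
  apply/integrableP; split => //.
  under eq_integral do rewrite gee0_abs//.
  exact: le_lt_trans intg (ltry _).
move=> /(_ measurableT); apply: filterS => w /(_ I) gfin.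
have sq_cvg : cvgn (series (fun k => (X k w) ^+ 2)).
  apply: nondecreasing_is_cvgn.
    by apply/nondecreasing_series => k _ _; exact: sqr_ge0.
  exists (fine (g w)) => _ [n _ <-].
  rewrite -lee_fin fineK// /series/= -sumEFin.
  by apply: nneseries_lim_ge => k _ _; exact: f0.
have /cvg0_le_normP sq0 := cvg_series_cvg_0 sq_cvg.
apply/cvg0_le_normP => eps eps0; have [n0 h] := sq0 _ (exprn_gt0 2 eps0).
exists n0 => n /h; rewrite normrX.
by rewrite ler_pXn2r// nnegrE// ltW.
Qed.

Lemma sum_inv_squares_le n : \sum_(0 <= k < n) (k.+1%:R ^+ 2)^-1 <= 2 :> R.
Proof.
(* Strengthened so that the induction telescopes: [1 / (n + 1)^2] is at most
   [2 / (n + 1) - 2 / (n + 2)]. *)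
suff : \sum_(0 <= k < n) (k.+1%:R ^+ 2)^-1 <= 2 - 2 * n.+1%:R^-1 :> R.
  by move/le_trans; apply; rewrite gerBl mulr_ge0// invr_ge0.
elim: n => [|n IH]; first by rewrite big_geq// invr1 mulr1 subrr.
rewrite big_nat_recr//= (le_trans (lerD IH (lexx _)))//.
rewrite -subr_ge0.
have n0 : 0 <= n%:R :> R by [].
rewrite [leRHS](_ : _ = n%:R / (n.+1%:R ^+ 2 * n.+2%:R)).
  by rewrite divr_ge0// mulr_ge0// exprn_ge0.
rewrite -[n.+2%:R]natr1 -[n.+1%:R]natr1; field.
by apply/andP; split; rewrite lt0r_neq0//; lra.
Qed.

Variable P : probability Omega R.

Lemma bounded_integrable (g : Omega -> R) (c : R) :
  measurable_fun setT g -> (forall w, `|g w| <= c) -> P.-integrable setT (EFin \o g).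
Proof.
move=> mg gc; apply: measurable_bounded_integrable => //.
  exact: le_lt_trans (probability_le1 P measurableT) (ltry _).
exists c; split; first exact: num_real.
by move=> x /ltW cx w _; exact: le_trans (gc w) cx.
Qed.

Section Increments.
Variables (M : nat -> Omega -> R) (K : R).
Hypothesis mM : forall t, measurable_fun setT (M t).
Hypothesis M0 : forall w, M 0%N w = 0.
Hypothesis M_incr : forall t w, `|M t.+1 w - M t w| <= K.
Hypothesis M_orth : forall t, \int[P]_w (M t w * (M t.+1 w - M t w)) = 0.

Let K_ge0 : 0 <= K.
Proof. exact: le_trans (M_incr 0%N point). Qed.

Lemma increments_le s t w : `|M (s + t)%N w - M s w| <= K * t%:R.
Proof.
elim: t => [|t IH]; first by rewrite addn0 subrr normr0 mulr0.
rewrite addnS -natr1 mulrDr mulr1 [leRHS]addrC.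
rewrite [X in `|X|](_ : _ = M (s + t).+1 w - M (s + t)%N w + (M (s + t)%N w - M s w)).
  by rewrite (le_trans (ler_normD _ _))// lerD.
by rewrite addrA subrK.
Qed.

Lemma walk_le t w : `|M t w| <= K * t%:R.
Proof. by have := increments_le 0 t w; rewrite M0 subr0. Qed.

(** Pythagoras: the cross term in the square of [M t + D] has integral zero, so each step adds at
    most [K ^ 2]. *)
Lemma second_moment_le t : \int[P]_w (M t w ^+ 2) <= K ^+ 2 * t%:R.
Proof.
elim: t => [|t IH].
  under eq_Rintegral do rewrite M0 expr0n/=.
  by rewrite Rintegral_cst// !mul0r mulr0.
pose D w := M t.+1 w - M t w.
have mD : measurable_fun setT D by apply: measurable_funB.
have intM : P.-integrable setT (EFin \o (fun w => M t w ^+ 2)).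
  apply: (@bounded_integrable _ ((K * t%:R) ^+ 2)); first exact: measurable_funX.
  by move=> w; rewrite normrX ler_pXn2r ?nnegrE ?mulr_ge0//; exact: walk_le.
have intD : P.-integrable setT (EFin \o (fun w => D w ^+ 2)).
  apply: (@bounded_integrable _ (K ^+ 2)); first exact: measurable_funX.
  by move=> w; rewrite normrX ler_pXn2r ?nnegrE//; exact: M_incr.
have intMD : P.-integrable setT (EFin \o (fun w => M t w * D w)).
  apply: (@bounded_integrable _ (K * t%:R * K)); first exact: measurable_funM.
  by move=> w; rewrite normrM ler_pM//; [exact: walk_le|exact: M_incr].
have int2MD : P.-integrable setT (EFin \o (fun w => 2 * (M t w * D w))).
  exact: (integrableZl measurableT 2 intMD).
have -> : \int[P]_w (M t.+1 w ^+ 2)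
    = \int[P]_w (M t w ^+ 2 + (2 * (M t w * D w) + D w ^+ 2)).
  by apply: eq_Rintegral => w _; rewrite /D; ring.
rewrite RintegralD//; last exact: (integrableD measurableT int2MD intD).
rewrite RintegralD// RintegralZl// M_orth mulr0 add0r -natr1 mulrDr mulr1 lerD//.
have <- : \int[P]_w (K ^+ 2) = K ^+ 2.
  have P1 := @probability_setT _ _ _ P; rewrite Rintegral_cst// -[RHS]mulr1.
  by congr *%R; rewrite [X in fine X]P1.
apply: le_Rintegral => //.
  by apply: (@bounded_integrable _ (K ^+ 2)) => // w; rewrite ger0_norm// sqr_ge0.
by move=> w _; rewrite -real_normK ?num_real// ler_pXn2r ?nnegrE//; exact: M_incr.
Qed.

(** Along [s = (k + 1)^2] the second moments of [M s / s] are at most [K^2 / (k + 1)^2], hence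
    summable. Up to the next square there are at most [2 (k + 1)] further steps, which change the
    quotient by [O(1 / k)]. *)
Lemma orthogonal_increments_slln :
  {ae P, forall w, (fun t => M t w / t%:R) @ \oo --> 0}.
Proof.
pose X k w := M (k.+1 ^ 2)%N w / (k.+1 ^ 2)%:R.
have mX k : measurable_fun setT (X k) by apply: measurable_funM.
have X_sum n : (\sum_(0 <= k < n) \int[P]_w ((X k w) ^+ 2)%:E <= (K ^+ 2 * 2)%:E)%E.
  apply: (@le_trans _ _ (\sum_(0 <= k < n) (K ^+ 2 * (k.+1%:R ^+ 2)^-1)%:E)%E); last first.
    by rewrite sumEFin lee_fin -mulr_sumr ler_wpM2l ?sqr_ge0// sum_inv_squares_le.
  apply: lee_sum => k _; set s := (k.+1 ^ 2)%N.
  have s0 : 0 < s%:R :> R by rewrite ltr0n expn_gt0.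
  have intM : P.-integrable setT (EFin \o (fun w => M s w ^+ 2)).
    apply: (@bounded_integrable _ ((K * s%:R) ^+ 2)); first exact: measurable_funX.
    by move=> w; rewrite normrX ler_pXn2r ?nnegrE ?mulr_ge0//; exact: walk_le.
  have intX : P.-integrable setT (EFin \o (fun w => X k w ^+ 2)).
    apply: (@bounded_integrable _ (K ^+ 2)); first exact: measurable_funX.
    move=> w; rewrite normrX ler_pXn2r ?nnegrE// normrM normfV (gtr0_norm s0).
    by rewrite ler_pdivrMr//; exact: walk_le.
  rewrite -[X in (X <= _)%E]fineK ?integrable_fin_num// lee_fin -/(Rintegral _ _ _).
  have -> : \int[P]_w (X k w ^+ 2) = \int[P]_w (M s w ^+ 2 * (s%:R^-1) ^+ 2).
    by apply: eq_Rintegral => w _; rewrite /X exprMn.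
  rewrite RintegralZr//.
  rewrite (le_trans (ler_wpM2r (sqr_ge0 _) (second_moment_le s)))//.
  by rewrite -mulrA [_^-1 ^+ 2]expr2 [s%:R * _]mulrA divff ?gt_eqF// mul1r /s natrX.
have := summable_squares_cvg0 mX X_sum; apply: filterS => w /cvg0_le_normP X0.
apply/cvg0_le_normP => eps eps0; have eps20 : 0 < eps / 2 by rewrite divr_gt0.
have [n0 hX] := X0 _ eps20.
(* Makes [2 K / (k + 1)] at most [eps / 2] for [k >= n1]. *)
pose n1 := Num.truncn (2 * K / (eps / 2)).
exists ((maxn n0 n1).+1 ^ 2)%N => t ht.
have [k /andP[st ts]] : exists k, (k.+1 ^ 2 <= t < k.+2 ^ 2)%N.
  by apply: exists_square_bracket; rewrite (leq_trans _ ht)// expn_gt0.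
have /andP[n0k n1k] : (n0 <= k)%N && (n1 <= k)%N.
  rewrite -geq_max -ltnS -[(_ < _)%N]ltnS -(@ltn_exp2r _ _ 2)//.
  exact: leq_ltn_trans ht ts.
set s := (k.+1 ^ 2)%N in st.
have s0 : 0 < s%:R :> R by rewrite ltr0n expn_gt0.
have t0 : 0 < t%:R :> R by rewrite (lt_le_trans s0)// ler_nat.
have tsE : t%:R^-1 <= s%:R^-1 :> R by rewrite lef_pV2// ler_nat.
rewrite -[M t w](subrK (M s w)) mulrDl [eps]splitr.
rewrite (le_trans (ler_normD _ _))// lerD//.
- have := increments_le s (t - s) w; rewrite subnKC// => hst.
  rewrite normrM normfV (gtr0_norm t0).
  have h2 : (t - s)%:R <= 2 * k.+1%:R :> R.
    by rewrite -natrM ler_nat; move: ts st; rewrite /s !expnS !expn0; lia.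
  apply: (@le_trans _ _ (K * (2 * k.+1%:R) * s%:R^-1)).
    by apply: ler_pM => //; rewrite (le_trans hst)// ler_wpM2l.
  rewrite [leLHS](_ : _ = 2 * K / k.+1%:R).
    rewrite ler_pdivrMr// -ler_pdivrMl// mulrC.
    by rewrite (le_trans (ltW (truncnS_gt _)))// ler_nat ltnS.
  by rewrite /s natrX; field; rewrite addrC natr1.
- rewrite (le_trans _ (hX _ n0k))// !normrM ler_wpM2l//.
  by rewrite !normfV (gtr0_norm t0) (gtr0_norm s0).
Qed.
End Increments.
End OrthogonalIncrements.

Lemma measurable_sum_cond (d : measure_display) (T : measurableType d)
    (R : realType) (D : set T) (I : Type) (r : seq I) (Q : pred I) (h : I -> T -> R) :
  (forall i, Q i -> measurable_fun D (h i)) ->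
  measurable_fun D (fun x => \sum_(i <- r | Q i) h i x).
Proof.
move=> mh; under eq_fun do rewrite big_mkcond.
by apply: measurable_sum => i; case: (boolP (Q i)) => [/mh|].
Qed.

(** * Orthogonality to finitely valued functions *)

Section CenteredProducts.
Context (d : measure_display) (Omega : measurableType d) (R : realType).
Variable P : probability Omega R.

Lemma Rintegral_sum_eq0 (D : set Omega) (I : Type) (r : seq I) (Q : pred I)
    (f : I -> Omega -> R) :
  measurable D -> (forall i, Q i -> P.-integrable D (EFin \o f i)) ->
  (forall i, Q i -> \int[P]_(w in D) f i w = 0) ->
  P.-integrable D (EFin \o (fun w => \sum_(i <- r | Q i) f i w)) /\
  \int[P]_(w in D) (\sum_(i <- r | Q i) f i w) = 0.
Proof.
move=> mD intf f0.
have -> : (fun w => \sum_(i <- r | Q i) f i w) = \sum_(i <- r | Q i) f i.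
  by apply/funext => w; rewrite fct_sumE.
elim/big_ind: _ => [|g h [intg g0] [inth h0]|i Qi]; last by split; [exact: intf|exact: f0].
  split; last by rewrite Rintegral_cst// mul0r.
  by apply: integrable0.
split; first exact: (integrableD mD intg inth).
by rewrite RintegralD// g0 h0 addr0.
Qed.

(** Split the integral over the level sets of [g], which belong to [G]: on each, [g] is a constant
    factor and [x] integrates to zero. *)
Lemma Rintegral_finite_range_mul_eq0 (G : set (set Omega)) (s : seq R)
    (g x : Omega -> R) (c : R) :
  (forall A, G A -> measurable A) -> (forall v, G (g @^-1` [set v])) ->
  (forall w, g w \in s) ->
  measurable_fun setT x -> (forall w, `|x w| <= c) ->
  (forall A, G A -> \int[P]_(w in A) x w = 0) ->
  \int[P]_w (g w * x w) = 0.
Proof.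
move=> Gm Gg gs mx xc x0.
have mg v : measurable (g @^-1` [set v]) by exact/Gm/Gg.
pose f v w := v * (x \_ (g @^-1` [set v])) w.
have -> : \int[P]_w (g w * x w) = \int[P]_w (\sum_(v <- undup s) f v w).
  (* Removing duplicates from [s] ensures that each level is counted once. *)
  apply: eq_Rintegral => w _; rewrite (bigD1_seq (g w)) ?mem_undup ?undup_uniq//=.
  rewrite big1 ?addr0 => [|v vg]; rewrite /f patchE.
    by rewrite mem_set.
  by rewrite memNset ?mulr0// => gv; rewrite -gv eqxx in vg.
have intx A : measurable A -> P.-integrable A (EFin \o x).
  by move=> mA; apply: integrableS (bounded_integrable P mx xc).
have intpx v : P.-integrable setT (EFin \o (x \_ (g @^-1` [set v]))).
  by rewrite -restrict_EFin; apply/integrable_restrict => //; rewrite setTI; exact: intx.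
apply: (Rintegral_sum_eq0 _ _ _ _).2 => // v _.
  exact: (integrableZl measurableT v (intpx v)).
by rewrite RintegralZl// -Rintegral_mkcond x0 ?mulr0.
Qed.

End CenteredProducts.

Section FiniteRange.
Variables (T : Type) (R : realType).

(** At a fixed time the urn quantities take finitely many values, so orthogonality needs no
    approximation by simple functions. *)
Definition finite_range (f : T -> R) := exists s : seq R, forall w, f w \in s.

Lemma finite_range_comp2 (op : R -> R -> R) f g :
  finite_range f -> finite_range g -> finite_range (fun w => op (f w) (g w)).
Proof.
move=> [s fs] [s' gs]; exists [seq op x y | x <- s, y <- s'] => w.
exact: allpairs_f.
Qed.

Lemma finite_range_cst c : finite_range (fun=> c).
Proof. by exists [:: c] => w; rewrite inE. Qed.

Lemma finite_range_sum (I : Type) (r : seq I) (Q : pred I) (f : I -> T -> R) :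
  (forall i, Q i -> finite_range (f i)) ->
  finite_range (fun w => \sum_(i <- r | Q i) f i w).
Proof.
move=> ff; have -> : (fun w => \sum_(i <- r | Q i) f i w) = \sum_(i <- r | Q i) f i.
  by apply/funext => w; rewrite fct_sumE.
elim/big_ind: _ => [|g h fg fh|]; [exact: finite_range_cst| |exact: ff].
exact: (finite_range_comp2 +%R fg fh).
Qed.

End FiniteRange.

(** * The noise of the urn process *)

Section UrnProcess.
Context (d : measure_display) (Omega : measurableType d) (R : realType).
Variables (P : probability Omega R) (N : nat) (e : rel 'I_N) (q : 'I_N -> R).
Variables (m alpha beta : 'I_N -> nat) (W0 B0 : 'I_N -> nat).
Variables (W B : nat -> 'I_N -> Omega -> nat) (chi : nat -> 'I_N -> Omega -> bool).
Hypothesis q_range : forall i, 0 <= q i <= 1.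
Hypothesis alpha_le : forall i, (alpha i <= m i)%N.
Hypothesis beta_le : forall i, (beta i <= m i)%N.
Hypothesis process : is_urn_process P e q m alpha beta W0 B0 W B chi.

Let Z := urn_fraction R W B.
Let F := urn_filtration Z.

Definition urn_total (t : nat) (i : 'I_N) : nat := (W0 i + B0 i + t * mbar e m i)%N.

Definition white_prob (t : nat) (j : 'I_N) (w : Omega) : R :=
  q j * Z t j w + (1 - q j) * (1 - Z t j w).

(** The white balls sent by [j] number [(m - beta) + (alpha + beta - m) * chi], affine in the
    draw. *)
Definition reinforcement_slope (j : 'I_N) : R :=
  (alpha j)%:R + (beta j)%:R - (m j)%:R.

Definition mean_white (t : nat) (j : 'I_N) (w : Omega) : R :=
  (m j)%:R - (beta j)%:R + reinforcement_slope j * white_prob t j w.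

(* The increments are written through [W] rather than [chi]: the filtration is
   generated by the fractions, for which [chi] need not be measurable. *)
Definition urn_noise (i : 'I_N) (t : nat) (w : Omega) : R :=
  (W t i w)%:R - (W0 i)%:R
  - \sum_(s < t) \sum_(j in in_nbr e i) mean_white s j w.

(** Each in-neighbour [j] sends [m j] balls whatever the colour drawn, so the total is not
    random. *)
Lemma urn_totalE t i w : (W t i w + B t i w)%N = urn_total t i.
Proof.
elim: t => [|t IH].
  by rewrite (urn_initW process) (urn_initB process) /urn_total mul0n addn0.
rewrite (urn_stepW process) (urn_stepB process) addnACA IH /urn_total mulSn.
rewrite -big_split/= /mbar [(\sum_(j in _) m j + _)%N]addnC addnA; congr (_ + _)%N.
apply: eq_bigr => j _; have := alpha_le j; have := beta_le j.
by case: (chi _ _ _) => /=; lia.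
Qed.

Lemma urn_fractionE t i w : Z t i w = (W t i w)%:R / (urn_total t i)%:R.
Proof. by rewrite /Z /urn_fraction urn_totalE. Qed.

Lemma urn_fraction_ge0 t i w : 0 <= Z t i w.
Proof. by rewrite urn_fractionE divr_ge0. Qed.

Lemma urn_white_le t i w : (W t i w <= urn_total t i)%N.
Proof. by rewrite -(urn_totalE t i w) leq_addr. Qed.

Lemma urn_fraction_le1 t i w : Z t i w <= 1.
Proof.
(* An empty urn has fraction [0], by the convention on inverses. *)
rewrite urn_fractionE; have [->|T0] := posnP (urn_total t i).
  by rewrite invr0 mulr0.
by rewrite ler_pdivrMr ?ltr0n// mul1r ler_nat urn_white_le.
Qed.

Lemma white_prob_range t j w : 0 <= white_prob t j w <= 1.
Proof.
have /andP[q0 q1] := q_range j.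
have Z0 := urn_fraction_ge0 t j w; have Z1 := urn_fraction_le1 t j w.
by rewrite /white_prob; apply/andP; split; nra.
Qed.

Lemma reinforcement_slope_le j : `|reinforcement_slope j| <= (m j)%:R.
Proof.
have : (alpha j)%:R <= (m j)%:R :> R by rewrite ler_nat.
have : (beta j)%:R <= (m j)%:R :> R by rewrite ler_nat.
have : 0 <= (alpha j)%:R :> R by [].
have : 0 <= (beta j)%:R :> R by [].
by rewrite /reinforcement_slope ler_norml; lra.
Qed.

Lemma urn_stepW_real t i w : (W t.+1 i w)%:R = (W t i w)%:R
  + \sum_(j in in_nbr e i)
      ((m j)%:R - (beta j)%:R + reinforcement_slope j * (chi t.+1 j w)%:R) :> R.
Proof.
rewrite (urn_stepW process) natrD natr_sum; congr (_ + _).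
apply: eq_bigr => j _; rewrite /reinforcement_slope.
by rewrite natrD !natrM !natrB// ?leq_b1//; case: (chi _ _ _) => /=; ring.
Qed.

Lemma urn_noise_incr i t w : urn_noise i t.+1 w - urn_noise i t w
  = \sum_(j in in_nbr e i)
      reinforcement_slope j * ((chi t.+1 j w)%:R - white_prob t j w).
Proof.
rewrite /urn_noise big_ord_recr/= urn_stepW_real.
set S := \sum_(s < t) _.
have -> : \sum_(j in in_nbr e i) reinforcement_slope j
    * ((chi t.+1 j w)%:R - white_prob t j w)
  = \sum_(j in in_nbr e i) ((m j)%:R - (beta j)%:R
      + reinforcement_slope j * (chi t.+1 j w)%:R)
    - \sum_(j in in_nbr e i) mean_white t j w.
  by rewrite -sumrB; apply: eq_bigr => j _; rewrite /mean_white; ring.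
by ring.
Qed.

Lemma innovation_le t j w : `|(chi t.+1 j w)%:R - white_prob t j w| <= 1.
Proof.
have /andP[p0 p1] := white_prob_range t j w.
by rewrite ler_norml; case: (chi _ _ _) => /=; lra.
Qed.

Lemma urn_noise_incr_le i t w :
  `|urn_noise i t.+1 w - urn_noise i t w| <= (mbar e m i)%:R.
Proof.
rewrite urn_noise_incr (le_trans (ler_norm_sum _ _ _))// /mbar natr_sum.
apply: ler_sum => j _; rewrite normrM -[leRHS]mulr1.
by apply: ler_pM => //; [exact: reinforcement_slope_le|exact: innovation_le].
Qed.

Lemma urn_noise0 i w : urn_noise i 0%N w = 0.
Proof. by rewrite /urn_noise big_ord0 (urn_initW process) subrr subr0. Qed.

Lemma measurable_chi t j : measurable_fun setT (fun w => (chi t.+1 j w)%:R : R).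
Proof.
have -> : (fun w => (chi t.+1 j w)%:R : R) = \1_(chi t.+1 j @^-1` [set true]).
  apply/funext => w; rewrite indicE; congr (nat_of_bool _)%:R.
  by apply/idP/idP => [c|]; [rewrite mem_set|move=> /set_mem].
apply: measurable_indic; rewrite -[X in measurable X]setTI.
exact: (urn_chi_measurable process).
Qed.

Lemma measurable_white t i : measurable_fun setT (fun w => (W t i w)%:R : R).
Proof.
elim: t => [|t IH].
  by under eq_fun do rewrite (urn_initW process); exact: measurable_cst.
under eq_fun do rewrite urn_stepW_real.
apply: measurable_funD => //; apply: measurable_sum_cond => j _.
apply: measurable_funD => //; apply: measurable_funM => //; exact: measurable_chi.
Qed.

Lemma measurable_urn_fraction t i : measurable_fun setT (Z t i).
Proof.
have -> : Z t i = fun w => (W t i w)%:R * (urn_total t i)%:R^-1.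
  by apply/funext => w; exact: urn_fractionE.
by apply: measurable_funM => //; exact: measurable_white.
Qed.

Lemma urn_filtration_measurable t A : F t A -> measurable A.
Proof.
apply: smallest_sub; first exact: sigma_algebra_measurable.
move=> _ [s [i [C [_ mC ->]]]]; rewrite -[X in measurable X]setTI.
exact: measurable_urn_fraction.
Qed.

Lemma measurable_white_prob t j : measurable_fun setT (white_prob t j).
Proof.
have mZ := measurable_urn_fraction t j.
by apply: measurable_funD; apply: measurable_funM => //; exact: measurable_funB.
Qed.

Lemma measurable_innovation t j :
  measurable_fun setT (fun w => (chi t.+1 j w)%:R - white_prob t j w : R).
Proof.
by apply: measurable_funB; [exact: measurable_chi|exact: measurable_white_prob].
Qed.

Lemma innovation_centered t j A : F t A ->
  \int[P]_(w in A) ((chi t.+1 j w)%:R - white_prob t j w) = 0.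
Proof.
move=> FA; have mA := urn_filtration_measurable FA.
(* The singleton case of the conditional law: integrating [white_prob] over [A] gives the
   probability of [A] together with a white draw at [j]. *)
have [_ /(_ A FA) cp] := (urn_chi_law process) t [set j]%SET (fun=> true).
have intc : P.-integrable A (EFin \o (fun w => (chi t.+1 j w)%:R : R)).
  apply: (integrableS measurableT) => //; apply: (@bounded_integrable _ _ _ _ _ 1).
    exact: measurable_chi.
  by move=> w; case: (chi _ _ _); rewrite ?normr1 ?normr0.
have intp : P.-integrable A (EFin \o white_prob t j).
  apply: (integrableS measurableT) => //; apply: (@bounded_integrable _ _ _ _ _ 1).
    exact: measurable_white_prob.
  by move=> w; have /andP[p0 p1] := white_prob_range t j w; rewrite ger0_norm.
rewrite RintegralB//; apply/eqP; rewrite subr_eq0; apply/eqP.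
rewrite /Rintegral; congr fine.
have -> : (\int[P]_(w in A) (white_prob t j w)%:E
    = P (A `&` [set w | forall i, i \in [set j]%SET -> chi t.+1 i w = true]))%E.
  by rewrite -cp; apply: eq_integral => w _; rewrite big_set1.
have -> : [set w | forall i, i \in [set j]%SET -> chi t.+1 i w = true]
    = chi t.+1 j @^-1` [set true].
  apply/seteqP; split => w /= h; first by apply: h; rewrite inE.
  by move=> i; rewrite inE => /eqP ->.
have mc : measurable (chi t.+1 j @^-1` [set true]).
  by rewrite -[X in measurable X]setTI; exact: (urn_chi_measurable process).
rewrite setIC -integral_indic//; apply: eq_integral => w _.
rewrite indicE; congr (EFin (nat_of_bool _)%:R).
by apply/idP/idP => [c|]; [rewrite mem_set|move=> /set_mem].
Qed.

Lemma finite_range_urn_fraction t i : finite_range (Z t i).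
Proof.
exists [seq k%:R / (urn_total t i)%:R | k <- iota 0 (urn_total t i).+1] => w.
rewrite urn_fractionE; apply/mapP; exists (W t i w) => //.
by rewrite mem_iota add0n ltnS urn_white_le.
Qed.

Lemma urn_whiteE t i w : (W t i w)%:R = Z t i w * (urn_total t i)%:R :> R.
Proof.
rewrite urn_fractionE; have [T0|T0] := posnP (urn_total t i).
  by have := urn_white_le t i w; rewrite T0 leqn0 => /eqP ->; rewrite mulr0.
by rewrite divfK// pnatr_eq0 -lt0n.
Qed.

(** Only fractions up to time [t] occur on the right; this yields both adaptedness and finite
    range. *)
Lemma urn_noiseE i t w : urn_noise i t w =
  Z t i w * (urn_total t i)%:R - (W0 i)%:R
  - \sum_(s < t) \sum_(j in in_nbr e i) mean_white s j w.
Proof. by rewrite /urn_noise urn_whiteE. Qed.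

Lemma finite_range_urn_noise i t : finite_range (urn_noise i t).
Proof.
rewrite (funext (urn_noiseE i t)).
apply: (finite_range_comp2 (fun x y => x - y)).
  apply: (finite_range_comp2 (fun x y => x - y)); last exact: finite_range_cst.
  apply: (finite_range_comp2 *%R); last exact: finite_range_cst.
  exact: finite_range_urn_fraction.
apply: finite_range_sum => s _; apply: finite_range_sum => j _.
(* A unary image, obtained from the binary lemma with a dummy constant. *)
apply: (finite_range_comp2 (fun x _ => (m j)%:R - (beta j)%:R
  + reinforcement_slope j * (q j * x + (1 - q j) * (1 - x))))
  (finite_range_cst _ 0).
exact: finite_range_urn_fraction.
Qed.

Lemma urn_noise_adapted i t v : F t (urn_noise i t @^-1` [set v]).
Proof.
pose gens := [set A | exists s i C,
  [/\ (s <= t)%N, measurable C & A = Z s i @^-1` C]].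
(* [Omega] with the sigma-algebra [F t], so that membership in [F t] follows from the usual
   measurability rules. *)
pose TF := g_sigma_algebraType gens.
have mZ s k : (s <= t)%N -> measurable_fun (setT : set TF) (Z s k : TF -> R).
  move=> st _ C mC; rewrite setTI; apply: sub_sigma_algebra.
  by exists s, k, C.
have mN : measurable_fun (setT : set TF) (urn_noise i t : TF -> R).
  rewrite (funext (urn_noiseE i t)).
  apply: measurable_funB.
    by apply: measurable_funB => //; apply: measurable_funM => //; exact: mZ.
  apply: measurable_sum => s; apply: measurable_sum_cond => j _.
  have mZs := mZ s j (ltnW (ltn_ord s)).
  apply: measurable_funD => //; apply: measurable_funM => //.
  by apply: measurable_funD; apply: measurable_funM => //; exact: measurable_funB.
have := mN measurableT [set v] (measurable_set1 v).
by rewrite setTI.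
Qed.

Lemma measurable_urn_noise i t : measurable_fun setT (urn_noise i t).
Proof.
apply: measurable_funB.
  by apply: measurable_funB => //; exact: measurable_white.
apply: measurable_sum => s; apply: measurable_sum_cond => j _.
apply: measurable_funD => //; apply: measurable_funM => //.
exact: measurable_white_prob.
Qed.

(** The noise up to [t] has level sets in [F t], and its next increment is a combination of
    innovations centred on every event of [F t]. *)
Lemma urn_noise_orthogonal i t :
  \int[P]_w (urn_noise i t w * (urn_noise i t.+1 w - urn_noise i t w)) = 0.
Proof.
have [s fs] := finite_range_urn_noise i t.
apply: (@Rintegral_finite_range_mul_eq0 _ _ _ P (F t) s _ _ (mbar e m i)%:R) => //.
- exact: urn_filtration_measurable.
- exact: urn_noise_adapted.
- by apply: measurable_funB; exact: measurable_urn_noise.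
- exact: urn_noise_incr_le.
move=> A FA; have mA := urn_filtration_measurable FA.
under eq_Rintegral do rewrite urn_noise_incr.
have int_in j : P.-integrable A
    (EFin \o (fun w => (chi t.+1 j w)%:R - white_prob t j w : R)).
  apply: (integrableS measurableT) => //; apply: (@bounded_integrable _ _ _ _ _ 1).
    exact: measurable_innovation.
  exact: innovation_le.
apply: (Rintegral_sum_eq0 _ _ _ _).2 => // j _.
  exact: (integrableZl mA _ (int_in j)).
by rewrite RintegralZl// innovation_centered// mulr0.
Qed.

Lemma urn_noise_slln :
  {ae P, forall w, forall i, (fun t => urn_noise i t w / t%:R) @ \oo --> 0}.
Proof.
apply: filter_forall => i.
apply: (@orthogonal_increments_slln _ _ _ P _ (mbar e m i)%:R).
- exact: measurable_urn_noise.
- exact: urn_noise0.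
- exact: urn_noise_incr_le.
- exact: urn_noise_orthogonal.
Qed.

End UrnProcess.

(** * The interaction matrix *)

Section RowNorm.
Variable R : realType.

Lemma row_norm_leP n (v : 'rV[R]_n) (c : R) : 0 <= c ->
  `|v| <= c <-> forall k, `|v 0 k| <= c.
Proof.
move=> c0; rewrite [`|v|]/Num.norm/= mx_normrE; split.
  by move=> /bigmax_leP[_ h] k; exact: (h (0, k)).
move=> h; apply/bigmax_leP; split => // -[i k] _ /=; rewrite ord1; exact: h.
Qed.

Lemma row_entry_le n (v : 'rV[R]_n) k : `|v 0 k| <= `|v|.
Proof. exact: (row_norm_leP v (normr_ge0 v)).1. Qed.

Lemma mulmx_row_le n (v : 'rV[R]_n) (D : 'M[R]_n) :
  `|v *m D| <= (\sum_k \sum_l `|D k l|) * `|v|.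
Proof.
have D0 : 0 <= \sum_k \sum_l `|D k l|.
  by apply: sumr_ge0 => k _; apply: sumr_ge0.
apply/row_norm_leP => [|l]; first by rewrite mulr_ge0.
rewrite mxE (le_trans (ler_norm_sum _ _ _))// mulr_suml ler_sum// => k _.
rewrite normrM mulrC ler_pM ?row_entry_le//.
by rewrite (bigD1 l)//= lerDl sumr_ge0.
Qed.

(** Column sums bounded by [1] make right multiplication by [C] nonexpansive in the sup norm; the
    gap constant is the entry sum of the inverse of [1 - C]. *)
Lemma contractive_row_recursion_cvg0 n (C : 'M[R]_n) (y : nat -> 'rV[R]_n) :
  (forall l, \sum_k `|C k l| <= 1) -> 1%:M - C \in unitmx ->
  (forall l, (fun t => (y t - (t%:R^-1 *: \sum_(s < t) y s) *m C) 0 l) @ \oo --> 0) ->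
  y @ \oo --> (0 : 'rV[R]_n).
Proof.
move=> C1 Cunit r0.
apply: (@averaged_recursion_cvg0 _ _ (mulmxr C)
  (\sum_k \sum_l `|invmx (1%:M - C) k l|)) => [v|||].
- apply/row_norm_leP => // l; rewrite mxE (le_trans (ler_norm_sum _ _ _))//.
  apply: (@le_trans _ _ (\sum_k `|v| * `|C k l|)).
    by apply: ler_sum => k _; rewrite normrM ler_wpM2r ?row_entry_le.
  by rewrite -mulr_sumr -[leRHS]mulr1 ler_wpM2l.
- by apply: sumr_ge0 => k _; apply: sumr_ge0.
- move=> v /=; have {1}-> : v = (v - v *m C) *m invmx (1%:M - C).
    by rewrite -[X in X - _]mulmx1 -mulmxBr mulmxK.
  exact: mulmx_row_le.
apply/cvg0_le_normP => eps eps0.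
suff [n0 _ h] : \forall t \near \oo, forall l,
    `|(y t - (t%:R^-1 *: \sum_(s < t) y s) *m C) 0 l| <= eps.
  by exists n0 => t /h /(row_norm_leP _ (ltW eps0)).
apply: filter_forall => l.
by have /cvg0_le_normP/(_ _ eps0)[n0 h] := r0 l; exists n0.
Qed.

End RowNorm.

Section UrnMatrixEntries.
Variables (R : realType) (N : nat) (e : rel 'I_N) (q : 'I_N -> R).
Variables (m alpha beta : 'I_N -> nat).

(** The diagonal of [I_mx *m B_mx]; on Pólya nodes with [q] in [{0, 1}] it is a genuine sign. *)
Definition edge_sign (j : 'I_N) : R :=
  (2 * q j - 1) * ((alpha j)%:R / (m j)%:R + (beta j)%:R / (m j)%:R - 1).

Lemma mul_Atilde (x : 'rV[R]_N) i : i \in flexible e ->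
  (x *m Atilde_mx R e m) 0 i
  = (\sum_(j in in_nbr e i) x 0 j * (m j)%:R) / (mbar e m i)%:R.
Proof.
move=> iF; rewrite /Atilde_mx !mulmxA mul_mx_diag !mxE iF; congr (_ * _).
rewrite [RHS]big_mkcond; apply: eq_bigr => j _.
rewrite mul_mx_diag !mxE inE.
by case: (e j i); rewrite ?mulr1 ?mulr0.
Qed.

Lemma mul_IBA (x : 'rV[R]_N) i : i \in flexible e ->
  (x *m IBA_mx e q m alpha beta) 0 i
  = (\sum_(j in in_nbr e i) x 0 j * edge_sign j * (m j)%:R) / (mbar e m i)%:R.
Proof.
move=> iF; rewrite /IBA_mx (mulmxA x (_ *m _)) mul_Atilde// (mulmxA x); congr (_ / _).
apply: eq_bigr => j _; rewrite /I_mx /B_mx !mul_mx_diag !mxE /edge_sign.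
by rewrite mulrA.
Qed.

Lemma IBA_E j i : i \in flexible e -> IBA_mx e q m alpha beta j i
  = if e j i then edge_sign j * (m j)%:R / (mbar e m i)%:R else 0.
Proof.
move=> iF.
have -> : IBA_mx e q m alpha beta j i
    = (delta_mx 0 j *m IBA_mx e q m alpha beta : 'rV_N) 0 i.
  by rewrite -rowE [RHS]mxE.
rewrite mul_IBA//; have [eji|neji] := boolP (e j i).
  rewrite (bigD1 j) ?inE//= big1 ?addr0 => [|k /andP[_ kj]].
    by rewrite mxE !eqxx mul1r.
  by rewrite mxE eqxx (negbTE kj) !mul0r.
rewrite big1 ?mul0r// => k; rewrite inE => eki.
rewrite mxE eqxx/=; case: eqP => [kj|_]; last by rewrite !mul0r.
by rewrite -kj eki in neji.
Qed.

Hypothesis q_range : forall i, 0 <= q i <= 1.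
Hypothesis m_ge1 : forall i, (1 <= m i)%N.
Hypothesis alpha_le : forall i, (alpha i <= m i)%N.
Hypothesis beta_le : forall i, (beta i <= m i)%N.

Let ratio_range j (k : nat) : (k <= m j)%N -> 0 <= (k%:R / (m j)%:R : R) <= 1.
Proof.
move=> km; rewrite divr_ge0//= ler_pdivrMr ?ltr0n ?(m_ge1 j)//.
by rewrite mul1r ler_nat.
Qed.

Lemma edge_sign_factors_le j : `|2 * q j - 1| <= 1 /\
  `|(alpha j)%:R / (m j)%:R + (beta j)%:R / (m j)%:R - 1| <= 1 :> R.
Proof.
have /andP[q0 q1] := q_range j.
have /andP[a0 a1] := ratio_range (alpha_le j).
have /andP[b0 b1] := ratio_range (beta_le j).
by rewrite !ler_norml; split; lra.
Qed.

Lemma edge_sign_le1 j : `|edge_sign j| <= 1.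
Proof.
by have [h1 h2] := edge_sign_factors_le j; rewrite normrM mulr_ile1.
Qed.

(** Two factors in [[-1, 1]] have a product of modulus one only if both do: the first then forces
    [q j] to an endpoint, the second forces [alpha + beta] to be [0] or [2 m]. *)
Lemma edge_sign_norm1 j : `|edge_sign j| = 1 ->
  (q j = 0 \/ q j = 1) /\ ~~ non_polya_type (m j) (alpha j) (beta j).
Proof.
have [h1 h2] := edge_sign_factors_le j.
have /andP[q0 q1] := q_range j.
rewrite /edge_sign normrM => h.
have n1 : `|2 * q j - 1| = 1.
  by apply/eqP; rewrite eq_le h1/= -[leLHS]h -[leRHS]mulr1 ler_wpM2l.
have n2 : `|(alpha j)%:R / (m j)%:R + (beta j)%:R / (m j)%:R - 1| = 1 :> R.
  by move: h; rewrite n1 mul1r.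
split.
  by move: n1; case: (ger0P (2 * q j - 1)) => _ hq; [right|left]; lra.
rewrite /non_polya_type; apply/negP => /andP[ab0 ab2].
have m0 : 0 < (m j)%:R :> R by rewrite ltr0n; exact: m_ge1.
have s0 : 0 < ((alpha j + beta j)%:R / (m j)%:R) :> R.
  by rewrite divr_gt0// ltr0n.
have s2 : ((alpha j + beta j)%:R / (m j)%:R) < 2 :> R.
  by rewrite ltr_pdivrMr// -natrM ltr_nat.
move: n2; rewrite -mulrDl -natrD.
by case: (ger0P (_ - 1)) => _ hx; lra.
Qed.

Lemma polya_edge_sign j : polya_type (m j) (alpha j) (beta j) ->
  edge_sign j = 2 * q j - 1.
Proof.
move=> /andP[/eqP am /eqP bm]; rewrite /edge_sign am bm.
have m0 : (m j)%:R != 0 :> R by rewrite pnatr_eq0 -lt0n; exact: m_ge1.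
by rewrite divff// addrK mulr1.
Qed.

End UrnMatrixEntries.

Lemma lsubmx_mulmx (R : pzRingType) (nF nS : nat) (x : 'rV[R]_(nF + nS))
    (Q : 'M[R]_(nF + nS)) :
  lsubmx (x *m Q) = lsubmx x *m ulsubmx Q + rsubmx x *m dlsubmx Q.
Proof. by rewrite -{1}[Q]submxK -{1}[x]hsubmxK mul_row_block row_mxKl. Qed.

(** * Invertibility on the flexible block *)

Section FlexibleBlock.
Variables (R : realType) (nF nS : nat) (e : rel 'I_(nF + nS)).
Variables (q : 'I_(nF + nS) -> R) (m alpha beta : 'I_(nF + nS) -> nat).
Hypothesis weak_conn : weakly_connected e.
Hypothesis labelling : forall i : 'I_(nF + nS), (i \in flexible e) = (i < nF)%N.
Hypothesis q_range : forall i, 0 <= q i <= 1.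
Hypothesis m_ge1 : forall i, (1 <= m i)%N.
Hypothesis alpha_le : forall i, (alpha i <= m i)%N.
Hypothesis beta_le : forall i, (beta i <= m i)%N.
Hypothesis F_strong : strongly_connected_on e (flexible e).

Let IBA := IBA_mx e q m alpha beta.
Let c := edge_sign q m alpha beta.

Lemma lshift_flexible (k : 'I_nF) : lshift nS k \in flexible e.
Proof. by rewrite labelling /= ltn_ord. Qed.

Lemma rshift_stubborn (k : 'I_nS) : rshift nF k \notin flexible e.
Proof. by rewrite labelling /= -leqNgt leq_addr. Qed.

(** The weights [m j / mbar i] over all in-neighbours add up to [1]; signs of modulus at most one
    and the restriction to flexible rows only lower the sum. *)
Lemma flexible_col_sum_le1 l : \sum_k `|ulsubmx IBA k l| <= 1.
Proof.
have lF := lshift_flexible l; set i := lshift nS l in lF *.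
have mb0 : 0 < (mbar e m i)%:R :> R by rewrite ltr0n; exact: in_mass_gt0.
apply: (@le_trans _ _ (\sum_j `|IBA j i|)).
  rewrite big_split_ord/= -[leLHS]addr0 lerD ?sumr_ge0// le_eqVlt.
  by apply/orP; left; apply/eqP; apply: eq_bigr => k _; rewrite !mxE.
apply: (@le_trans _ _ ((\sum_(j in in_nbr e i) (m j)%:R) / (mbar e m i)%:R)).
  rewrite mulr_suml [leRHS]big_mkcond; apply: ler_sum => j _.
  rewrite /IBA IBA_E// inE; case: (e j i); last by rewrite normr0.
  rewrite normrM [`|_ * (m j)%:R|]normrM normfV !normr_nat ler_wpM2r ?invr_ge0//.
  by rewrite -[leRHS]mul1r ler_wpM2r// edge_sign_le1.
by rewrite -natr_sum divff// gt_eqF.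
Qed.

(** Extended by zero to the stubborn nodes, [v] is harmonic on the flexible ones, and the maximum
    principle applies. *)
Lemma fixed_row_edges (v : 'rV[R]_nF) : v *m ulsubmx IBA = v -> v != 0 ->
  exists u : 'I_(nF + nS) -> R,
    (forall i j, e j i -> [/\ u j * c j = u i, `|c j| = 1 & u j != 0]) /\
    (forall i, (i \in flexible e) = (u i != 0)).
Proof.
move=> vC /rV0Pn[k vk]; pose x : 'rV[R]_(nF + nS) := row_mx v 0.
pose u j := x 0 j.
have u_stub i : i \notin flexible e -> u i = 0.
  case: (split_ordP i) => l -> {i}; first by rewrite lshift_flexible.
  by rewrite /u /x row_mxEr mxE.
have [h1 h2] : (forall i j, e j i -> [/\ u j * c j = u i, `|c j| = 1 & u j != 0]) /\
    (forall i, i \in flexible e -> u i != 0).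
  apply: (@max_principle _ e F_strong R m c u _ _ u_stub _ (lshift nS k)) => //.
  - exact: edge_sign_le1.
  - move=> i; case: (split_ordP i) => l -> {i} lF; last first.
      by have := rshift_stubborn l; rewrite lF.
    rewrite -[RHS]/(_ / (mbar e m (lshift nS l))%:R) -mul_IBA// -/IBA.
    have /rowP/(_ l) := lsubmx_mulmx x IBA.
    by rewrite /x row_mxKl row_mxKr mul0mx addr0 vC mxE /u /x row_mxEl => ->.
  - by rewrite /u /x row_mxEl.
exists u; split=> // i; apply/idP/idP; first exact: h2.
by apply: contraNT => /u_stub ->.
Qed.

(** A kernel row is a fixed row, nonzero at every tail of an edge. So every tail is flexible, there
    are no stubborn nodes, and each condition is then refuted. *)
Lemma flexible_block_unit :
     (exists i, 0 < q i < 1)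
  \/ (exists2 i, i \in flexible e & non_polya_type (m i) (alpha i) (beta i))
  \/ (exists i, i \in stubborn e)
  \/ [/\ forall i, q i = 0 \/ q i = 1,
         forall i, i \in flexible e -> polya_type (m i) (alpha i) (beta i)
       & ~ admits_graph_partition e (flexible e)
             [set i in flexible e | q i == 1]%SET
             [set i in flexible e | q i == 0]%SET] ->
  1%:M - ulsubmx IBA \in unitmx.
Proof.
move=> conditions; rewrite unitmxE unitfE; apply/negP => /det0P[v v0].
rewrite mulmxBr mulmx1 => /eqP; rewrite subr_eq0 => /eqP/esym vC.
have [u [edges uF]] := fixed_row_edges vC v0.
have Fcl i k : e k i -> k \in flexible e.
  by move=> /edges[_ _]; rewrite uF.
have /rV0Pn[k _] := v0.
have stub0 := stubborn_eq0 weak_conn (lshift_flexible k) Fcl.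
have allF i : i \in flexible e by rewrite inE stub0 inE.
(* An edge leaving [i] is needed, since [fixed_row_edges] controls [c] at tails of edges. *)
have rigid i : (q i = 0 \/ q i = 1) /\ ~~ non_polya_type (m i) (alpha i) (beta i).
  have [j eij] := flexible_ex_out_nbr F_strong (allF i) Fcl.
  have [_ ci1 _] := edges _ _ eij.
  exact: (edge_sign_norm1 q_range m_ge1 alpha_le beta_le ci1).
case: conditions => [[i qi]|[[i _ npi]|[[i]|[q01 polya]]]].
- by have [[]] := rigid i => qE; rewrite qE ltxx ?andbF in qi.
- by have [_] := rigid i; rewrite npi.
- by rewrite stub0 inE.
(* The signs of [u] are the colouring: [c j] is [1] on preferential nodes and [-1] on
   de-preferential ones. *)
apply; apply: (@signed_graph_partition _ e _ _ _ (fun i => 0 < u i)) => //.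
- apply/setP => i; rewrite finset.in_setU ![i \in [set _ in _ | _]]inE !allF/=.
  by have [->|->] := q01 i; rewrite eqxx ?orbT.
- apply/pred0P => i /=; rewrite ![i \in [set _ in _ | _]]inE.
  by have [->|->] := q01 i; rewrite ?oner_eq0 ?[0 == 1]eq_sym ?oner_eq0 ?andbF.
- move=> i j _ _ eji; have [uji _ uj0] := edges _ _ eji.
  rewrite -uji /c polya_edge_sign ?polya// [j \in _]inE allF/=.
  have [->|->] := q01 j.
    rewrite [0 == 1]eq_sym oner_eq0 mulr0 sub0r mulrN1 oppr_gt0.
    by case: (ltgtP (u j) 0) uj0 => // ->; rewrite eqxx.
  by rewrite eqxx mulr1 [2]mulr2n addrK mulr1.
Qed.

End FlexibleBlock.

(** * Convergence *)

Section FlexibleDynamics.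
Context (d : measure_display) (Omega : measurableType d) (R : realType).
Variables (P : probability Omega R) (nF nS : nat) (e : rel 'I_(nF + nS)).
Variables (q : 'I_(nF + nS) -> R) (m alpha beta : 'I_(nF + nS) -> nat).
Variables (W0 B0 : 'I_(nF + nS) -> nat).
Variables (W B : nat -> 'I_(nF + nS) -> Omega -> nat).
Variables (chi : nat -> 'I_(nF + nS) -> Omega -> bool).
Hypothesis labelling : forall i : 'I_(nF + nS), (i \in flexible e) = (i < nF)%N.
Hypothesis q_range : forall i, 0 <= q i <= 1.
Hypothesis m_ge1 : forall i, (1 <= m i)%N.
Hypothesis alpha_le : forall i, (alpha i <= m i)%N.
Hypothesis beta_le : forall i, (beta i <= m i)%N.
Hypothesis process : is_urn_process P e q m alpha beta W0 B0 W B chi.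

Let IBA := IBA_mx e q m alpha beta.
Let Z0 : 'rV[R]_(nF + nS) := \row_i ((W0 i)%:R / (W0 i + B0 i)%:R).
Let zF : 'rV[R]_nF := Zstar_F e q m alpha beta Z0.
Let x (w : Omega) (t : nat) : 'rV[R]_(nF + nS) := \row_i urn_fraction R W B t i w.
Let y (w : Omega) (t : nat) : 'rV[R]_nF := lsubmx (x w t) - zF.

Hypothesis IBA_unit : 1%:M - ulsubmx IBA \in unitmx.

Lemma stubborn_fraction t i w : i \notin flexible e -> x w t 0 i = Z0 0 i.
Proof.
rewrite inE negbK inE => /eqP Ni.
suff [WE BE] : W t i w = W0 i /\ B t i w = B0 i.
  by rewrite !mxE /urn_fraction WE BE.
elim: t => [|t [IHW IHB]]; first by rewrite (urn_initW process) (urn_initB process).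
by rewrite (urn_stepW process) (urn_stepB process) Ni !big_set0 !addn0.
Qed.

Lemma rsubmx_fraction t w : rsubmx (x w t) = rsubmx Z0.
Proof.
apply/rowP => k; rewrite [LHS]mxE [RHS]mxE; apply: stubborn_fraction.
exact: rshift_stubborn.
Qed.

(** The closed formula, with its inverse cleared, as the equilibrium equation of the drift. *)
Lemma Zstar_F_fixed :
  zF = zF *m ulsubmx IBA + (rsubmx Z0 *m dlsubmx IBA
       + lsubmx (a_row R m alpha *m Atilde_mx R e m)
       - lsubmx (q_row q *m B_mx R m alpha beta *m Atilde_mx R e m)).
Proof.
apply/eqP; rewrite addrC -subr_eq -{1}[zF]mulmx1 -mulmxBr; apply/eqP.
by rewrite /zF /Zstar_F mulmxKV.
Qed.

(** The drift is affine in the fractions, with constant stubborn coordinates; subtracting the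
    equilibrium equation leaves a linear term in [y]. *)
Lemma mean_white_sum t (l : 'I_nF) w (i := lshift nS l) :
  \sum_(j in in_nbr e i) mean_white q m alpha beta W B t j w
  = (mbar e m i)%:R * (zF + y w t *m ulsubmx IBA) 0 l.
Proof.
have iF : i \in flexible e by exact: lshift_flexible.
have mb0 : (mbar e m i)%:R != 0 :> R.
  by rewrite pnatr_eq0 -lt0n; exact: in_mass_gt0.
have -> : zF + y w t *m ulsubmx IBA = lsubmx (x w t *m IBA
    + a_row R m alpha *m Atilde_mx R e m
    - q_row q *m B_mx R m alpha beta *m Atilde_mx R e m).
  rewrite {1}Zstar_F_fixed /y mulmxBl !linearD linearN /=.
  rewrite (lsubmx_mulmx (x w t)) rsubmx_fraction.
  by rewrite addrC -!addrA addKr.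
have entryDB (u v v' : 'rV[R]_(nF + nS)) :
    lsubmx (u + v - v') 0 l = u 0 i + v 0 i - v' 0 i by rewrite !mxE.
rewrite entryDB mul_IBA// !mul_Atilde// -mulrDl -mulrBl mulrCA divff// mulr1.
rewrite -big_split -sumrB /=; apply: eq_bigr => j _.
rewrite /B_mx mul_mx_diag !mxE /mean_white /reinforcement_slope /white_prob /edge_sign.
have m0 : (m j)%:R != 0 :> R by rewrite pnatr_eq0 -lt0n; exact: m_ge1.
by field.
Qed.

(** The decomposition [urn_noiseE] divided by [t * mbar]. As the total is [W0 + B0 + t * mbar], the
    initial balls leave an error of order [1 / t]. *)
Lemma flexible_recursion t (l : 'I_nF) w (i := lshift nS l) : (0 < t)%N ->
  (y w t - (t%:R^-1 *: \sum_(s < t) y w s) *m ulsubmx IBA) 0 l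
  = ((W0 i)%:R - (W0 i + B0 i)%:R * x w t 0 i) / (mbar e m i)%:R / t%:R
    + urn_noise e q m alpha beta W0 W B i t w / t%:R / (mbar e m i)%:R.
Proof.
move=> t0; have iF : i \in flexible e by exact: lshift_flexible.
have mb0 : (mbar e m i)%:R != 0 :> R.
  by rewrite pnatr_eq0 -lt0n; exact: in_mass_gt0.
have tn0 : t%:R != 0 :> R by rewrite pnatr_eq0 -lt0n.
rewrite (urn_noiseE alpha_le beta_le process) /urn_total -/i.
have -> : urn_fraction R W B t i w = y w t 0 l + zF 0 l.
  by rewrite /y !mxE subrK.
have -> : x w t 0 i = y w t 0 l + zF 0 l by rewrite /y !mxE subrK.
have -> : \sum_(s < t) \sum_(j in in_nbr e i) mean_white q m alpha beta W B s j w
    = (mbar e m i)%:R * (t%:R * zF 0 l + ((\sum_(s < t) y w s) *m ulsubmx IBA) 0 l).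
  rewrite mulmx_suml summxE.
  have -> : t%:R * zF 0 l = \sum_(s < t) zF 0 l by rewrite sumr_const card_ord mulr_natl.
  rewrite -big_split mulr_sumr; apply: eq_bigr => s _.
  by rewrite mean_white_sum mxE.
have entryBZ (u v : 'rV[R]_nF) c : (u - c *: v) 0 l = u 0 l - c * v 0 l.
  by rewrite !mxE.
rewrite -scalemxAl entryBZ.
move: (y w t 0 l) (zF 0 l) ((_ *m _) 0 l) => a z b.
by rewrite !natrD natrM; field; rewrite tn0 mb0.
Qed.

Lemma flexible_cvg : {ae P, forall w, y w @ \oo --> (0 : 'rV[R]_nF)}.
Proof.
have := urn_noise_slln q_range alpha_le beta_le process.
apply: filterS => w noise0.
apply: (@contractive_row_recursion_cvg0 _ _ (ulsubmx IBA)) => // l.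
  exact: flexible_col_sum_le1.
set i := lshift nS l; set T := (W0 i + B0 i)%N; pose b : R := (mbar e m i)%:R.
have b0 : 0 < b.
  by rewrite ltr0n; apply: in_mass_gt0 => //; exact: lshift_flexible.
pose D t := ((W0 i)%:R - T%:R * x w t 0 i) / b / t%:R : R.
have D0 : D @ \oo --> 0.
  apply/cvg0_le_normP => eps eps0.
  exists (Num.truncn (T%:R / b / eps)).+1 => t ht.
  have t0 : 0 < t%:R :> R by rewrite ltr0n (leq_trans _ ht).
  have xi0 : 0 <= x w t 0 i by rewrite mxE; exact: (urn_fraction_ge0 alpha_le beta_le process).
  have xi1 : x w t 0 i <= 1 by rewrite mxE; exact: (urn_fraction_le1 alpha_le beta_le process).
  have num_le : `|(W0 i)%:R - T%:R * x w t 0 i| <= T%:R.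
    have T0 : 0 <= T%:R :> R by [].
    have W0T : (W0 i)%:R <= T%:R :> R by rewrite ler_nat leq_addr.
    have W00 : 0 <= (W0 i)%:R :> R by [].
    by rewrite ler_norml; apply/andP; split; nra.
  rewrite !normrM !normfV (gtr0_norm b0) (gtr0_norm t0) ler_pdivrMr// [eps * _]mulrC.
  rewrite -ler_pdivrMr//; apply: (@le_trans _ _ (T%:R / b / eps)).
    by rewrite !ler_pM2r ?invr_gt0.
  by rewrite (le_trans (ltW (truncnS_gt _)))// ler_nat.
have : (fun t => D t + urn_noise e q m alpha beta W0 W B i t w / t%:R / b) @ \oo --> (0 : R).
  rewrite -[X in _ --> X]addr0; apply: cvgD => //.
  by rewrite -[X in _ --> X](mul0r b^-1); apply: cvgMl; exact: noise0.
(* The recursion divides by [t], so it is invoked from [t = 1] on. *)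
apply: cvg_trans; apply: near_eq_cvg; exists 1%N => // t /= t0.
by rewrite flexible_recursion.
Qed.

End FlexibleDynamics.

Theorem theorem3p1 (R : realType) (d : measure_display)
    (Omega : measurableType d) (P : probability Omega R)
    (nF nS : nat) (e : rel 'I_(nF + nS))
    (q : 'I_(nF + nS) -> R) (m alpha beta : 'I_(nF + nS) -> nat)
    (W0 B0 : 'I_(nF + nS) -> nat)
    (W B : nat -> 'I_(nF + nS) -> Omega -> nat)
    (chi : nat -> 'I_(nF + nS) -> Omega -> bool)
    (weak_conn : weakly_connected e)
    (labelling : forall i : 'I_(nF + nS), (i \in flexible e) = (i < nF)%N)
    (q_range : forall i, 0 <= q i <= 1)
    (m_ge1 : forall i, (1 <= m i)%N)
    (alpha_le : forall i, (alpha i <= m i)%N)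
    (beta_le : forall i, (beta i <= m i)%N)
    (node_types : forall i, polya_type (m i) (alpha i) (beta i)
                            \/ non_polya_type (m i) (alpha i) (beta i))
    (T0_gt0 : forall i, (0 < W0 i + B0 i)%N)
    (process : is_urn_process P e q m alpha beta W0 B0 W B chi)
    (F_strong : strongly_connected_on e (flexible e))
    (conditions :
         (exists i, 0 < q i < 1)
      \/ (exists2 i, i \in flexible e
                     & non_polya_type (m i) (alpha i) (beta i))
      \/ (exists i, i \in stubborn e)
      \/ [/\ forall i, q i = 0 \/ q i = 1,
             forall i, i \in flexible e -> polya_type (m i) (alpha i) (beta i)
           & ~ admits_graph_partition e (flexible e)
                 [set i in flexible e | q i == 1]%SET
                 [set i in flexible e | q i == 0]%SET]) :
  let Z0 : 'rV[R]_(nF + nS) := \row_i ((W0 i)%:R / (W0 i + B0 i)%:R) in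
  let Zstar : 'rV[R]_(nF + nS) :=
    row_mx (Zstar_F e q m alpha beta Z0) (rsubmx Z0) in
  (1%:M - ulsubmx (IBA_mx e q m alpha beta) : 'M[R]_nF) \in unitmx
  /\ {ae P, forall w,
       (fun t => \row_i urn_fraction R W B t i w) @ \oo --> Zstar}.
Proof.
move=> Z0 Zstar.
have IBA_unit : 1%:M - ulsubmx (IBA_mx e q m alpha beta) \in unitmx.
  exact: (flexible_block_unit weak_conn labelling q_range m_ge1 alpha_le beta_le
    F_strong conditions).
split=> //.
have := flexible_cvg labelling q_range m_ge1 alpha_le beta_le process IBA_unit.
apply: filterS => w /cvg0_le_normP y0; apply/cvgrPdist_le => eps eps0.
have [n0 h] := y0 eps eps0; exists n0 => // t /h yt.
have entryB n (u v : 'rV[R]_n) k : (u - v) 0 k = u 0 k - v 0 k by rewrite !mxE.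
apply/(row_norm_leP _ (ltW eps0)) => i; rewrite entryB.
(* Flexible coordinates are controlled by [y]; stubborn ones equal their limit at all times. *)
case: (split_ordP i) => k -> {i}.
  apply: le_trans yt; apply: le_trans (row_entry_le _ k).
  by rewrite distrC entryB row_mxEl [lsubmx _ _ _]mxE.
rewrite row_mxEr [rsubmx _ _ _]mxE.
by rewrite (stubborn_fraction process) ?subrr ?normr0 ?(ltW eps0) ?rshift_stubborn.
Qed.
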